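(* Let $d\geq 2$, let $P:\mathbb{R}^d\to\mathbb{R}$ be a quadratic polynomial with integral coefficients, let $Z=Z_P=\{\mathbf{x}\in\mathbb{R}^d: P(\mathbf{x})=0\}$, and let $Z_{\mathrm{reg}}=\{\mathbf{x}\in Z:\nabla P(\mathbf{x})\neq \mathbf{0}\}$. Let $\mu$ be a measure on $\mathbb{R}^{d-1}$ which is absolutely $\alpha$-friendly and Ahlfors $\delta$-regular, let $U\subset\mathbb{R}^{d-1}$ be an open set containing $\mathrm{Supp}(\mu)$, let $\Psi:U\to Z_{\mathrm{reg}}$ be a local coordinate chart, and let $\nu:=\Psi[\mu]$ be the pushforward of $\mu$ under $\Psi$. Then for every $c\geq 1$, \[ \dim_H\big(W_{c,Z}\cap \mathrm{Supp}(\nu)\big)\leq \delta-\alpha\Big(1-\frac1c\Big), \] where $\dim_H$ denotes Hausdorff dimension.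
   Context: Rational points are written $\frac{\mathbf{p}}{q}$ with $\mathbf{p}\in\mathbb{Z}^d$ primitive and $q$ a positive integer; $\|\cdot\|$ is the max norm. For $\mathbf{x}\in Z$, define $\omega_Z(\mathbf{x})=\sup\{c>0: \exists C=C(\mathbf{x})>0 \text{ and infinitely many } \frac{\mathbf{p}}{q}\in Z\cap\mathbb{Q}^d \text{ with } \|\mathbf{x}-\frac{\mathbf{p}}{q}\|\leq C q^{-c}\}$, and $W_{c,Z}=\{\mathbf{x}\in Z:\omega_Z(\mathbf{x})>c\}$. A locally finite Borel measure $\mu$ on $\mathbb{R}^k$ is absolutely $\alpha$-decaying ($\alpha>0$) if there are $\rho_0>0$ and $C>0$ such that for all $0<\rho\leq\rho_0$, all $\mathbf{x}\in\mathrm{Supp}(\mu)$, every affine hyperplane $\mathcal{L}\subset\mathbb{R}^k$ and every $\epsilon>0$, $\mu(B(\mathbf{x},\rho)\cap \mathcal{L}^{(\epsilon\rho)})\leq C\epsilon^\alpha\mu(B(\mathbf{x},\rho))$, where $A^{(r)}=\{\mathbf{y}:\mathrm{dist}(\mathbf{y},A)\leq r\}$ is the closed $r$-thickening. $\mu$ is Federer if there is $\rho_0>0$ with $\mu(B(\mathbf{x},2\rho))\leq C\mu(B(\mathbf{x},\rho))$ for all $\mathbf{x}\in\mathrm{Supp}(\mu)$, $0<\rho\leq\rho_0$. Absolutely $\alpha$-friendly means absolutely $\alpha$-decaying and Federer. $\mu$ is Ahlfors $\delta$-regular if there are $\rho_0>0$ and $C\geq1$ with $C^{-1}\rho^\delta\leq\mu(B(\mathbf{x},\rho))\leq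 C\rho^\delta$ for all $\mathbf{x}\in\mathrm{Supp}(\mu)$, $0<\rho\leq\rho_0$. A local coordinate chart $\Psi:U\to Z_{\mathrm{reg}}$ is a smooth diffeomorphism of $U$ onto an open subset of the manifold $Z_{\mathrm{reg}}$.
   Formalization: P is assumed irreducible over Q (the claim fails for P = x1·x2), μ is assumed nonzero, and Supp(ν) is taken inside the patch Ψ(U), i.e. Ψ(Supp μ), which is the usual support when Supp μ is compact; for the closure in R^d the claim can fail. *)

(* Defs.v *)
From HB Require Import structures.
From mathcomp Require Import all_boot all_order all_algebra.
From mathcomp Require Import all_classical all_reals all_analysis.
From mathcomp Require mpoly.
(* The notations of mpoly clash with those of the analysis library; the ones
   needed here are {mpoly T[n]} = mpoly n T and
   mpoly.msize, the total degree plus one. *)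
Import -(notations) mpoly.

Set Implicit Arguments.
Unset Strict Implicit.
Unset Printing Implicit Defensive.

Import Order.TTheory GRing.Theory Num.Theory.
Import numFieldNormedType.Exports.

Local Open Scope classical_set_scope.
Local Open Scope ring_scope.

(* Points of R^k are row vectors; the library norm on 'rV[R]_k is the max norm,
   and ball x rho is the open ball for that norm. *)

Section Quadric.
Variables (R : realType) (d : nat).
Implicit Type P : mpoly d int.

Definition quadratic P : Prop := mpoly.msize P = 3%N.

(* A quadric containing a regular piece of a rational hyperplane, such as
   x1 * x2 = 0, has omega >= d / (d - 1) > 1 on all of that hyperplane. *)
Definition irreducible_over_rat P : Prop :=
  forall f g : mpoly d rat,
    map_mpoly (intr : int -> rat) P = f * g ->
    (mpoly.msize f <= 1)%N \/ (mpoly.msize g <= 1)%N.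

Definition real_eval P (x : 'rV[R]_d) : R :=
  meval (fun i => x ord0 i) (map_mpoly (intr : int -> R) P).

Definition gradient P (x : 'rV[R]_d) : 'rV[R]_d :=
  \row_i real_eval (mderiv i P) x.

Definition zero_locus P : set 'rV[R]_d := [set x | real_eval P x = 0].

Definition regular_locus P : set 'rV[R]_d :=
  [set x | zero_locus P x /\ gradient P x != 0].

End Quadric.

Section IntrinsicApproximation.
Variables (R : realType) (d : nat).

Definition rational_point (p : 'rV[int]_d) (q : nat) : 'rV[R]_d :=
  \row_i ((p ord0 i)%:~R / q%:R).

(* q > 0 and (p, q) is a primitive vector of Z^(d+1), so that every rational
   point has exactly one such representation. *)
Definition lowest_terms (p : 'rV[int]_d) (q : nat) : Prop :=
  (0 < q)%N /\ gcdn q (\big[gcdn/0%N]_(i < d) `|p ord0 i|%N) = 1%N.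

Definition good_rational_points (Z : set 'rV[R]_d) (x : 'rV[R]_d) (c C : R)
    : set 'rV[R]_d :=
  [set r | Z r /\ exists p q, [/\ lowest_terms p q, r = rational_point p q
                                & `|x - r| <= C * q%:R `^ (- c)]].

(* The supremum is taken in [-oo, +oo]; it is -oo instead of 0 when no c > 0
   is admissible, which is immaterial for the sets very_well_approx below
   with c >= 0. *)
Definition omega (Z : set 'rV[R]_d) (x : 'rV[R]_d) : \bar R :=
  ereal_sup [set c%:E | c in
    [set c : R | 0 < c /\
       exists2 C : R, 0 < C & infinite_set (good_rational_points Z x c C)]].

Definition very_well_approx (c : R) (Z : set 'rV[R]_d) : set 'rV[R]_d :=
  [set x | Z x /\ (c%:E < omega Z x)%E].

End IntrinsicApproximation.

Section BorelMeasures.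
Variables (R : realType) (k : nat).

Definition borel_row : Type := g_sigma_algebraType (@open 'rV[R]_k).
HB.instance Definition _ := Measurable.on borel_row.

Implicit Type mu : {measure set borel_row -> \bar R}.

Definition locally_finite mu : Prop :=
  forall x : 'rV[R]_k, exists V : set 'rV[R]_k,
    [/\ open V, V x & (mu V < +oo)%E].

(* The support of m, seen as a measure on the topological subspace X. *)
Definition support_in (X : set 'rV[R]_k) (m : set 'rV[R]_k -> \bar R)
    : set 'rV[R]_k :=
  [set x | X x /\ forall V : set 'rV[R]_k, open V -> V x -> (0 < m V)%E].

Definition measure_support mu : set 'rV[R]_k := support_in setT mu.

Definition affine_hyperplane (L : set 'rV[R]_k) : Prop :=
  exists (a : 'rV[R]_k) (b : R),
    a != 0 /\ L = [set y | \sum_(i < k) a ord0 i * y ord0 i = b].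

Definition thickening (A : set 'rV[R]_k) (r : R) : set 'rV[R]_k :=
  [set y | (edist_inf A y <= r%:E)%E].

Definition absolutely_decaying (alpha : R) mu : Prop :=
  0 < alpha /\
  exists rho0 C : R, [/\ 0 < rho0, 0 < C &
    forall (rho : R) (x : 'rV[R]_k) (L : set 'rV[R]_k) (eps : R),
      0 < rho <= rho0 -> measure_support mu x -> affine_hyperplane L -> 0 < eps ->
      (mu (ball x rho `&` thickening L (eps * rho)) <=
         (C * eps `^ alpha)%:E * mu (ball x rho))%E].

Definition federer mu : Prop :=
  exists rho0 C : R, [/\ 0 < rho0, 0 < C &
    forall (x : 'rV[R]_k) (rho : R), measure_support mu x -> 0 < rho <= rho0 ->
      (mu (ball x (2 * rho)%R) <= C%:E * mu (ball x rho))%E].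

Definition absolutely_friendly (alpha : R) mu : Prop :=
  absolutely_decaying alpha mu /\ federer mu.

Definition ahlfors_regular (delta : R) mu : Prop :=
  exists rho0 C : R, [/\ 0 < rho0, 1 <= C &
    forall (x : 'rV[R]_k) (rho : R), measure_support mu x -> 0 < rho <= rho0 ->
      ((C^-1 * rho `^ delta)%:E <= mu (ball x rho))%E /\
      (mu (ball x rho) <= (C * rho `^ delta)%:E)%E].

End BorelMeasures.

Section Charts.
Variable R : realType.

Fixpoint Cr_on (m n : nat) (V : set 'rV[R]_m) (r : nat)
    (f : 'rV[R]_m -> 'rV[R]_n) : Prop :=
  (forall x, V x -> {for x, continuous f}) /\
  if r is r'.+1 then
    forall i : 'I_m,
      (forall x, V x -> derivable f x (delta_mx ord0 i)) /\
      Cr_on V r' ('D_(delta_mx ord0 i) f)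
  else True.

(* Meant for open V, so that the values of f off V are irrelevant. *)
Definition smooth_on (m n : nat) (V : set 'rV[R]_m)
    (f : 'rV[R]_m -> 'rV[R]_n) : Prop :=
  forall r, Cr_on V r f.

(* Smoothness on an arbitrary subset, in particular on a submanifold: local
   extendability to smooth maps on open sets of the ambient space. *)
Definition smooth_on_subset (m n : nat) (X : set 'rV[R]_m)
    (f : 'rV[R]_m -> 'rV[R]_n) : Prop :=
  forall x, X x -> exists (V : set 'rV[R]_m) (g : 'rV[R]_m -> 'rV[R]_n),
    [/\ open V, V x, smooth_on V g & forall z, V z -> X z -> g z = f z].

(* Only the values of psi on U matter. *)
Definition local_chart (k d : nat) (U : set 'rV[R]_k) (M : set 'rV[R]_d)
    (psi : 'rV[R]_k -> 'rV[R]_d) : Prop :=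
  [/\ open U, smooth_on U psi,
      exists2 V : set 'rV[R]_d, open V & psi @` U = M `&` V &
      exists2 phi : 'rV[R]_d -> 'rV[R]_k,
        forall x, U x -> phi (psi x) = x & smooth_on_subset (psi @` U) phi].

(* The pushforward of the restriction of mu to the domain U of the chart. As a
   measure on psi @` U its support is psi @` measure_support mu; this is also
   its support in R^d when measure_support mu is compact. Otherwise the support
   in R^d is the closure, which may have a larger Hausdorff dimension. *)
Definition chart_pushforward (k d : nat)
    (mu : {measure set borel_row R k -> \bar R}) (U : set 'rV[R]_k)
    (psi : 'rV[R]_k -> 'rV[R]_d) (A : set 'rV[R]_d) : \bar R :=
  mu (U `&` psi @^-1` A).

End Charts.

Section Hausdorff.
Variables (R : realType) (d : nat).
Implicit Type A : set 'rV[R]_d.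

(* 0 is added so that the empty set has diameter 0. *)
Definition diameter A : \bar R :=
  ereal_sup ([set 0%E] `|` [set (`|z.1 - z.2|)%:E | z in A `*` A]).

Definition hausdorff_premeasure (s eps : R) A : \bar R :=
  ereal_inf [set (\sum_(0 <= i <oo) diameter (F i) `^ s)%E | F in
    [set F : nat -> set 'rV[R]_d |
       A `<=` \bigcup_i F i /\ forall i, (diameter (F i) <= eps%:E)%E]].

Definition hausdorff_measure (s : R) A : \bar R :=
  ereal_sup [set hausdorff_premeasure s eps A | eps in [set e : R | 0 < e]].

(* Restricting to s > 0 avoids the 0 ^ 0 convention and does not change the
   infimum. The empty set has dimension 0. *)
Definition hausdorff_dim A : \bar R :=
  ereal_inf [set s%:E | s in
    [set s : R | 0 < s /\ hausdorff_measure s A = 0%E]].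

End Hausdorff.

(* Main.v *)
(** Write the quadric homogeneously, with integral polar form S. For rational
    points z = p / q and w = p' / q' of the quadric, S takes an integer value on
    (q, p) and (q', p') of size O(q q' |z - w|^2). Hence the rational points of
    height at most Q in a ball of radius small compared with 1 / Q are pairwise
    orthogonal: they span an isotropic subspace, and if its codimension were at
    most 1 the polynomial would have a linear factor over Q. So they lie on an
    affine subspace of dimension at most d - 2, whose preimage under the chart
    is, within a ball of radius r, at distance O(r^2) from a hyperplane.

    A point psi u within tau = rho^c of such a rational point, where
    Q = rho^(-1/b) with b > 1, therefore lies in thin slabs at all scales r
    between tau and rho. Decay and regularity give a cover of these u by
    O(rho^(-delta) (rho / tau)^(delta - alpha)) balls of radius tau, going from
    rho to tau in boundedly many steps r -> r^(1+g) with g <= 1. Summing over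
    rho = 2^(-bn) shows that the Hausdorff measure vanishes in every dimension
    s > delta - alpha (1 - 1/c). *)

Require Import Defs.
From mathcomp Require Import all_boot all_order all_algebra.
From mathcomp Require Import all_classical all_reals all_analysis.
From mathcomp Require mpoly.
From mathcomp Require Import ring lra.
Import -(notations) mpoly.
Set Implicit Arguments.
Unset Strict Implicit.
Unset Printing Implicit Defensive.

Import Order.TTheory GRing.Theory Num.Theory.
Import numFieldNormedType.Exports.
Local Open Scope classical_set_scope.
Local Open Scope ring_scope.

(** * Row vectors and second-order expansions *)

Section RowNorm.
Context {R : realDomainType} {n : nat}.
Implicit Types (x : 'rV[R]_n) (i : 'I_n).

Lemma ler_coord_norm x i : `|x ord0 i| <= `|x|.
Proof.
rewrite [leRHS]/Num.Def.normr /= mx_normrE.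
exact: (@le_bigmax _ _ _ _ (fun ij : 'I_1 * 'I_n => `|x ij.1 ij.2|) (ord0, i)).
Qed.

Lemma ler_norm_coord x (r : R) :
  0 <= r -> (forall i, `|x ord0 i| <= r) -> `|x| <= r.
Proof.
move=> r0 xr; rewrite [leLHS]/Num.Def.normr /= mx_normrE.
by apply: bigmax_le => // -[i j] _ /=; rewrite (ord1 i).
Qed.

Lemma norm_coord_max x : x != 0 -> exists i, `|x| = `|x ord0 i|.
Proof.
move=> x0; have : mx_norm x != 0 by apply: contra_neq x0; exact: mx_norm_eq0.
by move=> /mx_norm_neq0[[i j] /= xE]; exists j; rewrite (ord1 i) in xE.
Qed.

Lemma norm_delta_row i : `|delta_mx ord0 i : 'rV[R]_n| = 1.
Proof.
apply/eqP; rewrite eq_le; apply/andP; split.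
  by apply: ler_norm_coord => // j; rewrite mxE; case: (_ && _); rewrite ?normr1 ?normr0.
by apply: le_trans (ler_coord_norm _ i); rewrite mxE !eqxx normr1.
Qed.

End RowNorm.

Section MeanValue.
Context {R : realType}.

Lemma is_derive_line {V W : normedModType R} (f : V -> W) (y e : V) (t : R) :
  derivable f (y + t *: e) e ->
  is_derive t 1 (fun s : R => f (y + s *: e)) ('D_e f (y + t *: e)).
Proof.
move=> df.
have quotientE : (fun h : R =>
      h^-1 *: (((fun s => f (y + s *: e)) \o shift t) (h *: 1) - f (y + t *: e)))
    = (fun h => h^-1 *: ((f \o shift (y + t *: e)) (h *: e) - f (y + t *: e))).
  apply/funext => h /=; congr (_ *: (f _ - _)).
  by rewrite scalerDl /GRing.scale /= mulr1 addrCA.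
by apply: DeriveDef; rewrite /derivable /derive quotientE.
Qed.

Lemma mean_value_line {V : normedModType R} (f : V -> R) (y e : V) (t K : R) :
  (forall s, `|s| <= `|t| ->
     derivable f (y + s *: e) e /\ `|'D_e f (y + s *: e)| <= K) ->
  `|f (y + t *: e) - f y| <= K * `|t|.
Proof.
move=> df.
have mvt a b : a <= b -> (forall s, a <= s <= b -> `|s| <= `|t|) ->
    `|f (y + b *: e) - f (y + a *: e)| <= K * (b - a).
  move=> ab abt.
  have [||s sab ->] := @MVT_segment R (fun s => f (y + s *: e))
      (fun s => 'D_e f (y + s *: e)) a b ab.
  - move=> s; rewrite in_itv /= => /andP[/ltW sa /ltW sb].
    by apply: is_derive_line; apply: (df s _).1; rewrite abt ?sa.
  - apply: derivable_within_continuous => s; rewrite in_itv /= => /abt/df[dfs _].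
    by case: (is_derive_line dfs).
  move: sab; rewrite in_itv /= => /abt /df[_ dfs].
  by rewrite normrM (ger0_norm (x := b - a)) ?subr_ge0// ler_wpM2r ?subr_ge0.
have [t0|t0] := leP 0 t.
  have := mvt 0 t t0; rewrite scale0r addr0 subr0 (ger0_norm t0); apply.
  by move=> s /andP[s0 st]; rewrite ger0_norm.
have := mvt t 0 (ltW t0); rewrite scale0r addr0 sub0r distrC (ltr0_norm t0); apply.
by move=> s /andP[ts s0]; rewrite ler0_norm// lerN2.
Qed.

Lemma locally_bounded_family {T : topologicalType} {V : normedModType R}
    {I : finType} (F : I -> T -> V) (x : T) :
  (forall i, {for x, continuous (F i)}) ->
  exists2 K, 0 < K & \forall y \near x, forall i, `|F i y| <= K.
Proof.
move=> cF; exists (\sum_i `|F i x| + 1); first by rewrite ltr_wpDl// sumr_ge0.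
apply: filter_forall => i; apply: (cvgr_norm_le _ (cF i)).
by rewrite (bigD1 i)//= -addrA ltrDl ltr_wpDl// sumr_ge0.
Qed.

Lemma klipschitzP {V W : normedModType R} (k : R) (A : set V) (f : V -> W) :
  k.-lipschitz_A f <-> forall x y, A x -> A y -> `|f x - f y| <= k * `|x - y|.
Proof.
by split=> [lip x y Ax Ay|lip [x y] [/= Ax Ay]]; [exact: (lip (x, y))|exact: lip].
Qed.

End MeanValue.

Section PartialDerivatives.
Context {R : realType} {m : nat}.
Implicit Types (w z : 'rV[R]_m) (K : R).

Definition partials_le {V : normedModType R} K (A : set 'rV[R]_m)
    (f : 'rV[R]_m -> V) : Prop :=
  forall y i, A y ->
    derivable f y (delta_mx ord0 i) /\ `|'D_(delta_mx ord0 i) f y| <= K.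

(* Change w into z one coordinate at a time: for the max norm this path stays
   at distance at most |z - w| from w. *)
Lemma mean_value_partials_real (f : 'rV[R]_m -> R) w z K :
  partials_le K (closed_ball_ Num.norm w `|z - w|) f ->
  `|f z - f w| <= m%:R * K * `|z - w|.
Proof.
move=> df.
pose h k : 'rV[R]_m := \row_i (if (i < k)%N then z ord0 i else w ord0 i).
have h0 : h 0%N = w by apply/rowP => i; rewrite mxE ltn0.
have hm : h m = z by apply/rowP => i; rewrite mxE ltn_ord.
have hS (k : 'I_m) : h k.+1 = h k + (z ord0 k - w ord0 k) *: delta_mx ord0 k.
  apply/rowP => i; rewrite !mxE eqxx /= ltnS leq_eqVlt.
  have [->|ik] := eqVneq i k; first by rewrite eqxx ltnn /= mulr1 subrKC.
  by rewrite -val_eqE /= in ik; rewrite (negbTE ik) mulr0 addr0.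
have coord_zw (k : 'I_m) : `|z ord0 k - w ord0 k| <= `|z - w|.
  by have := ler_coord_norm (z - w) k; rewrite !mxE.
have near_w (k : 'I_m) s : `|s| <= `|z ord0 k - w ord0 k| ->
    closed_ball_ Num.norm w `|z - w| (h k + s *: delta_mx ord0 k).
  move=> sk; rewrite /closed_ball_ /= distrC; apply: ler_norm_coord => // i.
  rewrite !mxE eqxx /=.
  have [->|ik] := eqVneq i k.
    by rewrite ltnn mulr1 addrAC subrr add0r (le_trans sk).
  by rewrite mulr0 addr0; case: ifP => _ //; rewrite subrr normr0.
have coord_step (k : 'I_m) : `|f (h k.+1) - f (h k)| <= K * `|z - w|.
  have K0 : 0 <= K.
    by apply: le_trans (normr_ge0 _) (df w k _).2; rewrite /closed_ball_ /= subrr normr0.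
  apply: (@le_trans _ _ (K * `|z ord0 k - w ord0 k|)); last exact: ler_wpM2l.
  by rewrite hS; apply: mean_value_line => s /near_w; exact: df.
have -> : f z - f w = \sum_(k < m) (f (h k.+1) - f (h k)).
  rewrite -(big_mkord xpredT (fun k => f (h k.+1) - f (h k))).
  by rewrite telescope_sumr// hm h0.
apply: le_trans (ler_norm_sum _ _ _) _.
apply: (@le_trans _ _ (\sum_(k < m) K * `|z - w|)); first exact: ler_sum.
by rewrite sumr_const card_ord -[leLHS]mulr_natl mulrA.
Qed.

Context {n : nat}.
Implicit Types f : 'rV[R]_m -> 'rV[R]_n.

Lemma mean_value_partials f w z K : 0 <= K ->
  partials_le K (closed_ball_ Num.norm w `|z - w|) f ->
  `|f z - f w| <= m%:R * K * `|z - w|.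
Proof.
move=> K0 df; apply: ler_norm_coord; first by rewrite !mulr_ge0.
move=> j; rewrite !mxE; apply: (mean_value_partials_real (f := fun y => f y ord0 j)).
move=> y i /(df y i)[dy Dy]; split; first by move/derivable_mxP : dy; apply.
apply: le_trans Dy; rewrite (derive_mx dy).
by apply: le_trans (ler_coord_norm _ j); rewrite mxE.
Qed.

Lemma is_derive_mulmx (D : 'M[R]_(m, n)) w (a v : 'rV[R]_m) :
  is_derive a v (fun y => (y - w) *m D) (v *m D).
Proof.
have /cvg_near_cst Dcvg : \forall h \near 0^',
    h^-1 *: (((fun y => (y - w) *m D) \o shift a) (h *: v) - (a - w) *m D) = v *m D.
  near=> h; have h0 : h != 0 by near: h; exact: nbhs_dnbhs_neq.
  by rewrite /= -mulmxBl opprB addrA subrK addrK -scalemxAl scalerA mulVf// scale1r.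
by apply: DeriveDef; [apply/cvg_ex; exists (v *m D)|exact: cvg_lim Dcvg].
Unshelve. all: by end_near. Qed.

Definition partial_mx f w : 'M[R]_(m, n) := \matrix_i 'D_(delta_mx ord0 i) f w.

Definition taylor2_le K (A : set 'rV[R]_m) f : Prop :=
  K.-lipschitz_A f /\
  forall w z, A w -> A z ->
    `|f z - f w - (z - w) *m partial_mx f w| <= K * `|z - w| ^+ 2.

Lemma taylor2_partials f w z K1 K2 : 0 <= K2 ->
  partials_le K1 (closed_ball_ Num.norm w `|z - w|) f ->
  (forall i,
    partials_le K2 (closed_ball_ Num.norm w `|z - w|) ('D_(delta_mx ord0 i) f)) ->
  `|f z - f w - (z - w) *m partial_mx f w| <= m%:R * (m%:R * K2) * `|z - w| ^+ 2.
Proof.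
move=> K20 df ddf; set D := partial_mx f w.
pose h y := f y - (y - w) *m D.
have -> : f z - f w - (z - w) *m D = h z - h w.
  by rewrite /h subrr mul0mx subr0 addrAC.
have -> : m%:R * (m%:R * K2) * `|z - w| ^+ 2 = m%:R * (m%:R * K2 * `|z - w|) * `|z - w|.
  by ring.
apply: mean_value_partials => [|y i yw]; first by rewrite !mulr_ge0.
have dfy : is_derive y (delta_mx ord0 i) f ('D_(delta_mx ord0 i) f y).
  by apply: DeriveDef => //; exact: (df y i yw).1.
have dh := is_deriveB dfy (is_derive_mulmx D w y (delta_mx ord0 i)).
split; first by case: dh.
rewrite derive_val -rowE rowK; apply: (@le_trans _ _ (m%:R * K2 * `|y - w|)).
  apply: (mean_value_partials (f := 'D_(delta_mx ord0 i) f)) => // x j xw.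
  by apply: ddf; rewrite /closed_ball_ /= (le_trans xw)// distrC.
by rewrite ler_wpM2l ?mulr_ge0// distrC.
Qed.

Lemma C2_expansion (V : set 'rV[R]_m) f x : open V -> V x -> Cr_on V 2 f ->
  exists eta K, [/\ 0 < eta, 0 < K, ball x eta `<=` V & taylor2_le K (ball x eta) f].
Proof.
move=> oV Vx [_ /= Cf].
have [K1 K10 bnd1] := locally_bounded_family (fun i => (Cf i).2.1 x Vx).
have [K2 K20 bnd2] :=
  locally_bounded_family (fun ij : 'I_m * 'I_m => ((Cf ij.1).2.2 ij.2).2.1 x Vx).
have Vnbhs : nbhs x V by exact: open_nbhs_nbhs.
have [eps /= eps0 derivative_bounds] :=
  (nbhs_ballP _ _).1 (filterI Vnbhs (filterI bnd1 bnd2)).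
pose K := m%:R * K1 + m%:R * (m%:R * K2) + 1.
have K0 : 0 < K by rewrite ltr_wpDl// addr_ge0// !mulr_ge0// ltW.
have third_sub : ball x (eps / 3) `<=` ball x eps by apply: le_ball; lra.
have near_w w z y : ball x (eps / 3) w -> ball x (eps / 3) z ->
    closed_ball_ Num.norm w `|z - w| y -> ball x eps y.
  rewrite -!ball_normE /closed_ball_ /= => xw xz yw.
  have := ler_distD w x y; have := ler_distD x z w.
  by rewrite (distrC z x); lra.
have df w z : ball x (eps / 3) w -> ball x (eps / 3) z ->
    partials_le K1 (closed_ball_ Num.norm w `|z - w|) f.
  move=> xw xz y i /(near_w _ _ _ xw xz)/derivative_bounds[Vy [B1 _]].
  by split; [exact: (Cf i).1|exact: B1].
have ddf w z i : ball x (eps / 3) w -> ball x (eps / 3) z ->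
    partials_le K2 (closed_ball_ Num.norm w `|z - w|) ('D_(delta_mx ord0 i) f).
  move=> xw xz y j /(near_w _ _ _ xw xz)/derivative_bounds[Vy [_ B2]].
  by split; [exact: ((Cf i).2.2 j).1|exact: (B2 (i, j))].
exists (eps / 3), K; split=> [|//|y /third_sub/derivative_bounds[]//|].
  by rewrite divr_gt0.
split=> [|w z xw xz].
  apply/klipschitzP => z w xz xw.
  apply: le_trans (mean_value_partials (ltW K10) (df _ _ xw xz)) _.
  by rewrite ler_wpM2r// /K -addrA lerDl addr_ge0// !mulr_ge0// ltW.
apply: le_trans (taylor2_partials (ltW K20) (df _ _ xw xz) _) _.
  by move=> i; exact: ddf.
by rewrite ler_wpM2r ?exprn_ge0// /K -addrA addrCA lerDl addr_ge0// !mulr_ge0// ltW.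
Qed.

End PartialDerivatives.

(** * Isotropic subspaces of split symmetric forms *)

Section LinearAlgebra.
Context {F : fieldType}.

Lemma mxrank_le1_outer {m n : nat} (A : 'M[F]_(m, n)) : (\rank A <= 1)%N ->
  exists (u : 'cV[F]_m) (v : 'rV[F]_n), A = u *m v.
Proof.
move=> A1; rewrite -(mulmx_base A); move: (col_base A) (row_base A).
case: (\rank A) A1 => [|[|//]] _ u v; last by exists u, v.
by exists 0, 0; rewrite mul0mx thinmx0 mul0mx.
Qed.

Lemma mx_corank1_projection {r n : nat} (M : 'M[F]_(r, n)) : (n <= (\rank M).+1)%N ->
  exists (l : 'cV[F]_n) (e : 'rV[F]_n), (1%:M - l *m e <= M)%MS.
Proof.
move=> corank1; pose N := genmx M.
have MN : \rank N = \rank M by exact: mxrank_gen.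
have [|l [e le]] := @mxrank_le1_outer n n (proj_mx N^C%MS N).
  apply: leq_trans (_ : \rank (N^C)%MS <= 1)%N; last first.
    by rewrite mxrank_compl MN leq_subLR addn1.
  by rewrite -[proj_mx _ _]mul1mx; apply/mxrankS/proj_mx_sub.
exists l, e; rewrite -le -(genmxE M) -/N.
have NC : (1%:M <= N + N^C)%MS by rewrite sub1mx addsmx_compl_full.
rewrite -{1}(add_proj_mx (capmx_compl N) NC) !mul1mx addrK -[proj_mx N _]mul1mx.
exact: proj_mx_sub.
Qed.

Lemma mxrank_lt_ker_col {m n : nat} (A : 'M[F]_(m, n)) : (\rank A < n)%N ->
  exists2 a : 'cV[F]_n, a != 0 & A *m a = 0.
Proof.
move=> An; have : kermx A^T != 0.
  by rewrite kermx_eq0 /row_free mxrank_tr neq_ltn An.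
move=> /rowV0Pn[v /sub_kermxP vA v0]; exists v^T; first by rewrite trmx_eq0.
by apply: trmx_inj; rewrite trmx_mul trmxK vA trmx0.
Qed.

Lemma spanning_rows {n : nat} (V : set 'rV[F]_n) :
  exists r (M : 'M[F]_(r, n)),
    (forall i, V (row i M)) /\ forall v, V v -> (v <= M)%MS.
Proof.
pose Q k := `[< exists r (M : 'M[F]_(r, n)), (forall i, V (row i M)) /\ \rank M = k >].
have Q0 : exists k, Q k.
  by exists 0%N; apply/asboolP; exists 0%N, 0; split; [case|exact: mxrank0].
have Qn k : Q k -> (k <= n)%N by move=> /asboolP[r [M [_ <-]]]; exact: rank_leq_col.
have [_ /asboolP[r [M [VM <-]]] rank_max] := ex_maxnP Q0 Qn.
exists r, M; split=> // v Vv; apply: contraT => vM.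
have : Q (\rank (col_mx v M)).
  apply/asboolP; exists (1 + r)%N, (col_mx v M); split=> // i.
  rewrite -(splitK i); case: (fintype.split i) => j /=; last by rewrite rowKd.
  by rewrite rowKu (ord1 j) row_id.
move=> /rank_max; rewrite leqNgt -addsmxE => /negP; case; apply: rank_ltmx.
by rewrite ltmxE addsmxSr /= addsmx_sub (negbTE vM).
Qed.

End LinearAlgebra.

Section BilinearForm.
Context {T : nzRingType} {n : nat}.
Implicit Types (A B : 'M[T]_n) (v w : 'rV[T]_n).

Definition bilform A v w : T := (v *m A *m w^T) ord0 ord0.

Lemma bilformD A B v w : bilform (A + B) v w = bilform A v w + bilform B v w.
Proof. by rewrite /bilform mulmxDr mulmxDl mxE. Qed.

Lemma bilform_delta i j v w : bilform (delta_mx i j) v w = v ord0 i * w ord0 j.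
Proof.
rewrite /bilform -(mul_delta_mx (ord0 : 'I_1)) mulmxA -mulmxA -colE -rowE.
by rewrite mxE big_ord1 !mxE.
Qed.

Lemma bilform_row {r : nat} A (M : 'M[T]_(r, n)) i j :
  bilform A (row i M) (row j M) = (M *m A *m M^T) i j.
Proof.
rewrite /bilform -row_mul tr_row !mxE.
by apply: eq_bigr => k _; rewrite [in LHS]mxE [in X in _ * X]mxE.
Qed.

End BilinearForm.

Lemma rmorph_bilform {S T : nzRingType} (f : {rmorphism S -> T}) {n : nat}
    (A : 'M[S]_n) (v w : 'rV[S]_n) :
  f (bilform A v w) = bilform (map_mx f A) (map_mx f v) (map_mx f w).
Proof. by rewrite /bilform map_trmx -!map_mxM [RHS]mxE. Qed.

Section CommutativeBilinearForm.
Context {T : comNzRingType} {n : nat}.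
Implicit Types (A : 'M[T]_n) (v w : 'rV[T]_n) (l h : 'cV[T]_n).

Lemma bilformZ A a b v w : bilform A (a *: v) (b *: w) = a * b * bilform A v w.
Proof. by rewrite /bilform linearZ /= -scalemxAr -!scalemxAl scalerA mxE (mulrC b). Qed.

Lemma scale_bilform A a v w : bilform (a *: A) v w = a * bilform A v w.
Proof. by rewrite /bilform -scalemxAr -scalemxAl mxE. Qed.

Lemma bilform_tr A v w : bilform A^T v w = bilform A w v.
Proof.
rewrite /bilform -[v in LHS]trmxK -trmx_mul -trmx_mul mulmxA.
by rewrite [LHS]mxE.
Qed.

Lemma bilform_polar A v : bilform (A + A^T) v v = bilform A v v *+ 2.
Proof. by rewrite bilformD bilform_tr mulr2n. Qed.

Lemma bilform_outer l h v w :
  bilform (l *m h^T) v w = (v *m l) ord0 ord0 * (w *m h) ord0 ord0.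
Proof.
rewrite /bilform mulmxA -mulmxA -trmx_mul [LHS]mxE big_ord1.
by rewrite [(_ *m _)^T _ _]mxE.
Qed.

Lemma bilform_sym_outer l h v :
  bilform (l *m h^T + h *m l^T) v v = ((v *m l) ord0 ord0 * (v *m h) ord0 ord0) *+ 2.
Proof. by rewrite bilformD !bilform_outer mulr2n (mulrC ((v *m h) _ _)). Qed.

Lemma bilform_sub A v w : bilform A v v = 0 -> bilform A w w = 0 ->
  bilform A (v - w) (v - w) = - bilform (A + A^T) v w.
Proof.
have -> : bilform A (v - w) (v - w)
    = bilform A v v - bilform A v w - (bilform A w v - bilform A w w).
  rewrite /bilform linearB /= mulmxBr !mulmxBl.
  move: (v *m A *m v^T) (v *m A *m w^T) (w *m A *m v^T) (w *m A *m w^T) => vv vw wv ww.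
  by rewrite !mxE; ring.
by move=> -> ->; rewrite sub0r subr0 bilformD bilform_tr opprD.
Qed.

End CommutativeBilinearForm.

Lemma bilform_norm_le {R : realDomainType} {n : nat} (A : 'M[R]_n) (v w : 'rV[R]_n) :
  `|bilform A v w| <= (\sum_i \sum_j `|A i j|) * `|v| * `|w|.
Proof.
rewrite /bilform -mulmxA mxE; apply: le_trans (ler_norm_sum _ _ _) _.
rewrite !mulr_suml; apply: ler_sum => i _.
rewrite normrM -[leRHS]mulrA [leRHS]mulrCA ler_pM ?ler_coord_norm//.
rewrite mxE mulr_suml; apply: le_trans (ler_norm_sum _ _ _) _.
by apply: ler_sum => j _; rewrite normrM ler_wpM2l// mxE ler_coord_norm.
Qed.

Definition split_symmetric {T : nzRingType} {n : nat} (S : 'M[T]_n) : Prop :=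
  exists l h : 'cV[T]_n, S = l *m h^T + h *m l^T.

Section IsotropicSubspace.
Context {F : fieldType} {n : nat} (S : 'M[F]_n).
Hypotheses (char2 : 2%:R != 0 :> F) (S_sym : S^T = S).

(* Rows of p := 1 - l e lie in M, so p S p^T = 0; expanding this expresses S
   through l and S e^T. *)
Lemma isotropic_corank1_split {r : nat} (M : 'M[F]_(r, n)) :
  M *m S *m M^T = 0 -> (n <= (\rank M).+1)%N -> split_symmetric S.
Proof.
move=> iso /mx_corank1_projection[l [e /submxP[X pM]]].
pose s := bilform S e e; pose g := S *m e^T.
have gT : g^T = e *m S by rewrite trmx_mul trmxK S_sym.
have ss : l *m e *m S *m e^T *m l^T = s *: (l *m l^T).
  have -> : l *m e *m S *m e^T = l *m (e *m S *m e^T) by rewrite !mulmxA.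
  by rewrite [e *m S *m e^T]mx11_scalar mul_mx_scalar -scalemxAl.
have : (1%:M - l *m e) *m S *m (1%:M - l *m e)^T = 0.
  by rewrite pM trmx_mul !mulmxA -(mulmxA X) -(mulmxA X) iso mulmx0 mul0mx.
rewrite linearB /= trmx1 trmx_mul mulmxBl mul1mx mulmxBr mulmx1 mulmxBl !mulmxA ss.
rewrite -/g -(mulmxA l) -gT => expand; exists l, (g - (s / 2%:R) *: l).
rewrite linearB linearZ /= mulmxBr mulmxBl -scalemxAr -scalemxAl.
move: (l *m g^T) (g *m l^T) (l *m l^T) expand => lg gl ll /matrixP expand.
apply/matrixP => i j; have := expand i j; rewrite !mxE => Sij.
by rewrite -[LHS]subr0 -Sij; field.
Qed.

Lemma isotropic_span (V : set 'rV[F]_n) :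
  (forall v w, V v -> V w -> bilform S v w = 0) ->
  ~ split_symmetric S ->
  exists r (M : 'M[F]_(r, n)), ((\rank M).+1 < n)%N /\ forall v, V v -> (v <= M)%MS.
Proof.
move=> iso nosplit; have [r [M [VM MV]]] := spanning_rows V.
exists r, M; split=> //; rewrite ltnNge; apply/negP => corank1; apply: nosplit.
apply: isotropic_corank1_split corank1.
by apply/matrixP => i j; rewrite -bilform_row iso// mxE.
Qed.

End IsotropicSubspace.

(** * Quadratic polynomials *)

Lemma map_mx_intr {S T : nzRingType} (f : {rmorphism S -> T}) {m n : nat}
    (A : 'M[int]_(m, n)) :
  map_mx f (map_mx intr A) = map_mx intr A.
Proof. by apply/matrixP => i j; rewrite !mxE rmorph_int. Qed.

Section QuadraticPolynomials.
Context {d : nat}.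

Definition homogenize {T : nzRingType} (x : 'rV[T]_d) : 'rV[T]_(1 + d) :=
  row_mx 1%:M x.

Lemma norm_homogenize_sub {R : realDomainType} (z w : 'rV[R]_d) :
  `|homogenize z - homogenize w| <= `|z - w|.
Proof.
apply: ler_norm_coord => // i; rewrite /homogenize opp_row_mx add_row_mx subrr.
rewrite -(splitK i); case: (fintype.split i) => j /=.
  by rewrite row_mxEl mxE normr0.
by rewrite row_mxEr ler_coord_norm.
Qed.

Lemma map_homogenize {S T : nzRingType} (f : {rmorphism S -> T}) (x : 'rV[S]_d) :
  map_mx f (homogenize x) = homogenize (map_mx f x).
Proof. by rewrite /homogenize map_row_mx map_mx1. Qed.

Definition homvars (T : nzRingType) : 'rV[mpoly d T]_(1 + d) :=
  homogenize (\row_i mpolyX T (mnm1 i)).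

Lemma homvars0 (T : nzRingType) : homvars T ord0 (lshift d ord0) = 1.
Proof. by rewrite /homvars /homogenize row_mxEl mxE. Qed.

Lemma homvarsS (T : nzRingType) i : homvars T ord0 (rshift 1 i) = mpolyX T (mnm1 i).
Proof. by rewrite /homvars /homogenize row_mxEr mxE. Qed.

Lemma map_homvars {S T : nzRingType} (f : {rmorphism S -> T}) :
  map_mx (map_mpoly f) (homvars S) = homvars T.
Proof.
rewrite /homvars map_homogenize; congr homogenize.
by apply/rowP => i; rewrite !mxE; exact: map_mpolyX.
Qed.

Lemma mpolyX_mdeg_le1 (T : nzRingType) (m : multinom d) : (mdeg m <= 1)%N ->
  exists i, mpolyX T m = homvars T ord0 i.
Proof.
rewrite leq_eqVlt ltnS leqn0 => /orP[/mdeg1P[i /eqP ->]|].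
  by exists (rshift 1 i); rewrite homvarsS.
by rewrite mdeg_eq0 => /eqP ->; exists (lshift d ord0); rewrite homvars0 mpolyX0.
Qed.

Lemma mpolyX_mdeg_le2 (T : nzRingType) (m : multinom d) : (mdeg m <= 2)%N ->
  exists i j, mpolyX T m = homvars T ord0 i * homvars T ord0 j.
Proof.
have [m1 _|m1 m2] := leqP (mdeg m) 1.
  have [i ->] := mpolyX_mdeg_le1 T m1.
  by exists i, (lshift d ord0); rewrite homvars0 mulr1.
have [i mi] : exists i, m i != 0%N.
  apply/existsP; apply: contraLR m1; rewrite negb_exists => /forallP m0.
  by rewrite mdegE big1// => i _; apply/eqP; move: (m0 i); rewrite negbK.
have mE : mnm_add (mnm_sub m (mnm1 i)) (mnm1 i) = m by apply: submK; rewrite lep1mP.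
have [|j mj] := @mpolyX_mdeg_le1 T (mnm_sub m (mnm1 i)).
  by rewrite -ltnS (leq_trans _ m2)// -[in leqRHS]mE mdegD mdeg1 addn1.
by exists j, (rshift 1 i); rewrite -{1}mE mpolyXD mj homvarsS.
Qed.

Definition quadratic_mpoly {T : comNzRingType} (A : 'M[T]_(1 + d)) : mpoly d T :=
  bilform (map_mx (mpolyC d (R:=T)) A) (homvars T) (homvars T).

Definition affine_mpoly {T : comNzRingType} (l : 'cV[T]_(1 + d)) : mpoly d T :=
  (homvars T *m map_mx (mpolyC d (R:=T)) l) ord0 ord0.

Lemma quadratic_mpoly_surj {T : comNzRingType} (P : mpoly d T) :
  (mpoly.msize P <= 3)%N -> exists A, P = quadratic_mpoly A.
Proof.
move=> P3; rewrite {1}[P]mpolyE big_seq.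
apply: (big_ind (fun p => exists A, p = quadratic_mpoly A)).
- by exists 0; rewrite /quadratic_mpoly /bilform map_mx0 mulmx0 mul0mx mxE.
- by move=> _ _ [A ->] [B ->]; exists (A + B); rewrite /quadratic_mpoly map_mxD bilformD.
move=> m mP; have [|i [j ->]] := @mpolyX_mdeg_le2 T m.
  by rewrite -ltnS (leq_trans _ P3)//; apply: msize_mdeg_lt.
exists (mcoeff m P *: delta_mx i j).
by rewrite /quadratic_mpoly map_mxZ map_delta_mx scale_bilform bilform_delta mul_mpolyC.
Qed.

Lemma map_quadratic_mpoly {S T : comNzRingType} (f : {rmorphism S -> T})
    (A : 'M[S]_(1 + d)) :
  map_mpoly f (quadratic_mpoly A) = quadratic_mpoly (map_mx f A).
Proof.
rewrite /quadratic_mpoly (rmorph_bilform (map_mpoly f)) map_homvars.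
suff -> : map_mx (map_mpoly f) (map_mx (mpolyC d (R:=S)) A)
    = map_mx (mpolyC d (R:=T)) (map_mx f A) by [].
by apply/matrixP => i j; rewrite !mxE; exact: map_mpolyC.
Qed.

Lemma meval_quadratic_mpoly {T : comNzRingType} (A : 'M[T]_(1 + d)) (x : 'rV[T]_d) :
  meval (fun i => x ord0 i) (quadratic_mpoly A) = bilform A (homogenize x) (homogenize x).
Proof.
rewrite /quadratic_mpoly (rmorph_bilform (meval (fun i => x ord0 i))).
have -> : map_mx (meval (fun i => x ord0 i)) (homvars T) = homogenize x.
  rewrite /homvars map_homogenize; congr homogenize.
  by apply/rowP => i; rewrite !mxE; exact: mevalXU.
suff -> : map_mx (meval (fun i => x ord0 i)) (map_mx (mpolyC d (R:=T)) A) = A by [].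
by apply/matrixP => i j; rewrite !mxE; exact: mevalC.
Qed.

Lemma msize_affine_mpoly {T : comNzRingType} (l : 'cV[T]_(1 + d)) :
  (mpoly.msize (affine_mpoly l) <= 2)%N.
Proof.
rewrite /affine_mpoly mxE.
apply: (big_ind (fun p : mpoly d T => (mpoly.msize p <= 2)%N)).
- by rewrite mmeasure0.
- by move=> p q hp hq; apply: leq_trans (mmeasureD_le _ _ _) _; rewrite geq_max hp.
move=> i _; rewrite [map_mx _ _ _ _]mxE mulrC mul_mpolyC.
apply: leq_trans (msizeZ_le _ _) _.
rewrite -(splitK i); case: (fintype.split i) => j /=.
  by rewrite (ord1 j) homvars0 msize1.
by rewrite homvarsS msizeX mdeg1.
Qed.

Lemma quadratic_mpoly_split {F : fieldType} (A : 'M[F]_(1 + d)) (l h : 'cV[F]_(1 + d)) :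
  2%:R != 0 :> F -> A + A^T = l *m h^T + h *m l^T ->
  quadratic_mpoly A = affine_mpoly l * affine_mpoly h.
Proof.
move=> char2 /(congr1 (map_mx (mpolyC d (R:=F)))).
rewrite !map_mxD !map_mxM -!map_trmx => AE.
have := bilform_polar (map_mx (mpolyC d (R:=F)) A) (homvars F).
rewrite AE bilform_sym_outer -[LHS]scaler_nat -[RHS]scaler_nat.
by move=> /(scalerI char2).
Qed.

Lemma irreducible_polar_nonsplit (A : 'M[int]_(1 + d)) :
  quadratic (quadratic_mpoly A) -> irreducible_over_rat (quadratic_mpoly A) ->
  ~ split_symmetric (map_mx intr (A + A^T) : 'M[rat]_(1 + d)).
Proof.
move=> quadA irrA [l [h]]; rewrite map_mxD -map_trmx => AE.
have := quadratic_mpoly_split (isT : 2%:R != 0 :> rat) AE.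
rewrite -(map_quadratic_mpoly (intr : int -> rat)) => fac.
have size3 : mpoly.msize (affine_mpoly l * affine_mpoly h) = 3%N.
  rewrite -fac -[RHS]quadA !msizeE; apply: perm_big.
  by apply: msupp_map_mpoly; exact: intr_inj.
have l0 : affine_mpoly l != 0.
  by apply/eqP => l0; move: size3; rewrite l0 mul0r mmeasure0.
have h0 : affine_mpoly h != 0.
  by apply/eqP => h0; move: size3; rewrite h0 mulr0 mmeasure0.
have : (mpoly.msize (affine_mpoly l) + mpoly.msize (affine_mpoly h) <= 3)%N.
  have [l1|h1] := irrA _ _ fac; first exact: leq_add l1 (msize_affine_mpoly h).
  exact: leq_add (msize_affine_mpoly l) h1.
have := msizeM l0 h0; rewrite size3.
by case: (_ + _)%N => //= n <-.
Qed.

End QuadraticPolynomials.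

(** * Rational points on a quadric *)

Section AffineSpan.
Context {F : fieldType} {d : nat}.

Lemma homogenize_neq0 (z : 'rV[F]_d) : homogenize z != 0.
Proof.
apply/eqP => /rowP/(_ (lshift d ord0))/eqP.
by rewrite /homogenize row_mxEl !mxE eqxx oner_eq0.
Qed.

(* Homogeneous coordinates raise the dimension of an affine span by one. *)
Definition affine_codim_ge2 (T : set 'rV[F]_d) : Prop :=
  exists r (W : 'M[F]_(r, 1 + d)),
    (\rank W < d)%N /\ forall z, T z -> (homogenize z <= W)%MS.

Lemma affine_codim_ge2_conormal {k : nat} (T : set 'rV[F]_d) (z0 : 'rV[F]_d)
    (D : 'M[F]_(d, k)) :
  (d <= k.+1)%N -> affine_codim_ge2 T -> T z0 ->
  exists2 a : 'cV[F]_k, a != 0 & forall z, T z -> (z - z0) *m D *m a = 0.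
Proof.
move=> dk [r [W [Wd TW]]] /TW Wz0; pose N := col_mx (- (z0 *m D)) D.
have NE z : homogenize z *m N = (z - z0) *m D.
  by rewrite /homogenize mul_row_col mul1mx mulmxBl addrC.
have ker_gt0 : (0 < \rank (W :&: kermx N))%N.
  rewrite lt0n mxrank_eq0; apply: contra_neq (homogenize_neq0 z0) => ker0.
  apply/eqP; rewrite -submx0 -ker0 sub_capmx Wz0; apply/sub_kermxP.
  by rewrite NE subrr mul0mx.
have [|a a0 WNa] := @mxrank_lt_ker_col F r k (W *m N).
  apply: (@leq_trans (\rank W)); last by rewrite -ltnS (leq_trans Wd).
  by rewrite -(mxrank_mul_ker W N) -addn1 leq_add2l.
exists a => // z /TW/submxP[X zW].
by rewrite -NE zW -2!mulmxA (mulmxA W) WNa mulmx0.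
Qed.

End AffineSpan.

Section RationalZeros.
Context {R : realType} {d : nat}.

Definition rational_zeros (P : mpoly d int) (Q : R) : set 'rV[R]_d :=
  [set z | zero_locus P z /\
    exists p q, [/\ (0 < q)%N, q%:R <= Q & z = rational_point R p q]].

Lemma real_eval_quadratic (A : 'M[int]_(1 + d)) (z : 'rV[R]_d) :
  real_eval (quadratic_mpoly A) z = bilform (map_mx intr A) (homogenize z) (homogenize z).
Proof. by rewrite /real_eval map_quadratic_mpoly meval_quadratic_mpoly. Qed.

Definition int_lift (p : 'rV[int]_d) (q : nat) : 'rV[int]_(1 + d) :=
  row_mx (q%:Z)%:M p.

Lemma homogenize_rational (p : 'rV[int]_d) (q : nat) : (0 < q)%N ->
  homogenize (rational_point R p q) = q%:R^-1 *: map_mx intr (int_lift p q).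
Proof.
move=> q0; have q_neq0 : (q%:R : R) != 0 by rewrite pnatr_eq0 -lt0n.
rewrite /homogenize /int_lift map_row_mx scale_row_mx; congr row_mx.
  by rewrite map_scalar_mx scale_scalar_mx mulVf.
by apply/rowP => i; rewrite !mxE mulrC.
Qed.

Lemma polar_int_lift (A : 'M[int]_(1 + d)) (p1 p2 : 'rV[int]_d) (q1 q2 : nat) :
  (0 < q1)%N -> (0 < q2)%N ->
  let z1 := rational_point R p1 q1 in let z2 := rational_point R p2 q2 in
  zero_locus (quadratic_mpoly A) z1 -> zero_locus (quadratic_mpoly A) z2 ->
  (bilform (A + A^T) (int_lift p1 q1) (int_lift p2 q2))%:~R =
    - (q1%:R * q2%:R * bilform (map_mx intr A)
        (homogenize z1 - homogenize z2) (homogenize z1 - homogenize z2)).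
Proof.
move=> q10 q20 z1 z2 Z1 Z2; rewrite bilform_sub -?real_eval_quadratic// mulrN opprK.
rewrite (rmorph_bilform (intr : int -> R)) !homogenize_rational// bilformZ.
rewrite map_mxD map_trmx -invfM mulrA mulfV ?mul1r//.
by rewrite mulf_neq0// pnatr_eq0 -lt0n.
Qed.

(* The polar form takes an integer value on the two integral lifts, and this
   value is smaller than 1. *)
Lemma rational_zeros_orthogonal (A : 'M[int]_(1 + d)) :
  exists2 kappa : R, 0 < kappa & forall (Q : R) p1 q1 p2 q2,
    (0 < q1)%N -> (0 < q2)%N -> q1%:R <= Q -> q2%:R <= Q ->
    zero_locus (quadratic_mpoly A) (rational_point R p1 q1) ->
    zero_locus (quadratic_mpoly A) (rational_point R p2 q2) ->
    `|rational_point R p1 q1 - rational_point R p2 q2| * Q <= kappa ->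
    bilform (A + A^T) (int_lift p1 q1) (int_lift p2 q2) = 0.
Proof.
pose C : R := \sum_i \sum_j `|map_mx intr A i j|.
have C0 : 0 <= C by apply: sumr_ge0 => ? _; apply: sumr_ge0.
exists (C + 1)^-1; first by rewrite invr_gt0 ltr_wpDl.
move=> Q p1 q1 p2 q2 q10 q20 q1Q q2Q Z1 Z2 z12Q.
apply: contrapT => /eqP polar0.
have := norm_intr_ge1 (intr_int R (bilform (A + A^T) (int_lift p1 q1) (int_lift p2 q2))).
rewrite intr_eq0 => /(_ polar0); apply/negP; rewrite -ltNge.
rewrite polar_int_lift// normrN normrM.
move: z12Q; set z1 := rational_point R p1 q1; set z2 := rational_point R p2 q2 => z12Q.
have Q0 : 0 <= Q by apply: le_trans q1Q.
apply: (@le_lt_trans _ _ (Q * Q * (C * `|z1 - z2| * `|z1 - z2|))).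
  apply: ler_pM => //; first by rewrite ger0_norm ?mulr_ge0// ler_pM.
  apply: le_trans (bilform_norm_le _ _ _) _.
  by rewrite !ler_pM ?mulr_ge0// norm_homogenize_sub.
have -> : Q * Q * (C * `|z1 - z2| * `|z1 - z2|) = C * (`|z1 - z2| * Q) ^+ 2 by ring.
apply: (@le_lt_trans _ _ (C * (C + 1)^-1 ^+ 2)).
  by rewrite ler_wpM2l// lerXn2r ?nnegrE ?mulr_ge0 ?invr_ge0 ?addr_ge0.
rewrite exprVn ltr_pdivrMr ?exprn_gt0 ?ltr_wpDl// mul1r.
by rewrite sqrrD1 -addrA ltr_wpDl ?exprn_ge0// mulr2n; lra.
Qed.

Lemma rational_zeros_span (P : mpoly d int) :
  quadratic P -> irreducible_over_rat P ->
  exists2 kappa : R, 0 < kappa & forall (Q : R) (T : set 'rV[R]_d),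
    T `<=` rational_zeros P Q ->
    (forall z w, T z -> T w -> `|z - w| * Q <= kappa) ->
    affine_codim_ge2 T.
Proof.
move=> quadP; have [|A PE] := quadratic_mpoly_surj (P := P); first by rewrite quadP.
rewrite PE in quadP * => irrP.
have [kappa kappa0 ortho] := rational_zeros_orthogonal A.
exists kappa => // Q T TP Tk.
pose V : set 'rV[rat]_(1 + d) := [set v | exists p q, [/\ (0 < q)%N, q%:R <= Q,
  T (rational_point R p q) & v = map_mx intr (int_lift p q)]].
have [||r [M [rankM VM]]] := isotropic_span (S := map_mx intr (A + A^T)) (V := V)
    (isT : 2%:R != 0 :> rat) _ _ (irreducible_polar_nonsplit quadP irrP).
- by rewrite map_trmx linearD /= trmxK addrC.
- move=> _ _ [p1 [q1 [q10 q1Q T1 ->]]] [p2 [q2 [q20 q2Q T2 ->]]].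
  rewrite -(rmorph_bilform (intr : int -> rat)).
  by rewrite (ortho Q)//; [exact: (TP _ T1).1|exact: (TP _ T2).1|exact: Tk].
exists r, (map_mx ratr M); rewrite mxrank_map; split=> // z Tz.
have [_ [p [q [q0 qQ zE]]]] := TP z Tz.
rewrite zE homogenize_rational//; apply: scalemx_sub.
rewrite -(map_mx_intr (@ratr R)) map_submx; apply: VM.
by exists p, q; split=> //; rewrite -zE.
Qed.

End RationalZeros.

(** * Covers by small balls *)

Section Slab.
Context {R : realType} {k : nat}.
Implicit Types (a y z : 'rV[R]_k) (b t : R).

Definition dot a y : R := \sum_(i < k) a ord0 i * y ord0 i.

Lemma dotD a y z : dot a (y + z) = dot a y + dot a z.
Proof. by rewrite /dot -big_split; apply: eq_bigr => i _; rewrite mxE mulrDr. Qed.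

Lemma dotB a y z : dot a (y - z) = dot a y - dot a z.
Proof. by rewrite /dot -sumrB; apply: eq_bigr => i _; rewrite !mxE mulrBr. Qed.

Lemma dotZ a y t : dot a (t *: y) = t * dot a y.
Proof. by rewrite /dot mulr_sumr; apply: eq_bigr => i _; rewrite mxE mulrCA. Qed.

Lemma dotC a y : dot a y = dot y a.
Proof. by apply: eq_bigr => i _; rewrite mulrC. Qed.

Lemma dot_delta a i : dot a (delta_mx ord0 i) = a ord0 i.
Proof.
rewrite /dot (bigD1 i)//= big1 ?addr0; last first.
  by move=> j ji; rewrite mxE eqxx (negbTE ji) mulr0.
by rewrite mxE !eqxx mulr1.
Qed.

Lemma dot_mulmx (a : 'cV[R]_k) y : dot a^T y = (y *m a) ord0 ord0.
Proof. by rewrite /dot mxE; apply: eq_bigr => i _; rewrite mxE mulrC. Qed.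

Lemma dot_norm_le a y : `|dot a y| <= k%:R * `|a| * `|y|.
Proof.
apply: le_trans (ler_norm_sum _ _ _) _.
apply: (@le_trans _ _ (\sum_(i < k) `|a| * `|y|)).
  by apply: ler_sum => i _; rewrite normrM ler_pM// ler_coord_norm.
by rewrite sumr_const card_ord -[leLHS]mulr_natl mulrA.
Qed.

Lemma affine_hyperplane_dot a b : a != 0 -> affine_hyperplane [set y | dot a y = b].
Proof. by move=> a0; exists a, b. Qed.

Lemma thickening_norm_le (L : set 'rV[R]_k) y y' t :
  L y' -> `|y - y'| <= t -> thickening L t y.
Proof.
move=> Ly' yy't; rewrite /thickening /=; apply/lee_addgt0Pr => e e0.
apply: (@le_trans _ _ (edist (y, y'))); first by apply: ereal_inf_lbound; exists y'.
have te : 0 < t + e by rewrite ltr_wpDl// (le_trans _ yy't).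
rewrite -EFinD; apply: edist_fin => //=; rewrite -ball_normE /=.
by apply: le_lt_trans yy't _; rewrite ltrDl.
Qed.

(* Correcting the coordinate where a is largest reaches the hyperplane. *)
Lemma slab_thickening a y b t : a != 0 ->
  `|dot a y - b| <= t * `|a| -> thickening [set y | dot a y = b] t y.
Proof.
move=> a0 yb; have [i ai] := norm_coord_max a0.
have ai0 : a ord0 i != 0 by rewrite -normr_gt0 -ai normr_gt0.
pose s := (dot a y - b) / a ord0 i.
apply: (thickening_norm_le (y' := y - s *: delta_mx ord0 i)) => /=.
  by rewrite dotB dotZ dot_delta divfK// subKr.
rewrite subKr normrZ norm_delta_row mulr1 normrM normfV -ai.
by rewrite ler_pdivrMr// normr_gt0.
Qed.

Lemma slab_ball_thickening a y b t s : a != 0 -> `|dot a y - b| <= t * `|a| ->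
  ball y s `<=` thickening [set y | dot a y = b] (t + k%:R * s).
Proof.
move=> a0 yb u; rewrite -ball_normE /= => yu; apply: slab_thickening => //.
have -> : dot a u - b = (dot a y - b) - dot a (y - u) by rewrite dotB; ring.
apply: le_trans (ler_normB _ _) _; rewrite mulrDl lerD//.
by apply: le_trans (dot_norm_le _ _) _; rewrite mulrAC ler_wpM2r// ler_wpM2l// ltW.
Qed.

Lemma measurable_open_rV (V : set 'rV[R]_k) :
  open V -> measurable (V : set (borel_row R k)).
Proof. by move=> oV; apply: sub_sigma_algebra. Qed.

Lemma measurable_ball_rV y (r : R) : measurable (ball y r : set (borel_row R k)).
Proof. by apply: measurable_open_rV; exact: ball_open. Qed.

Lemma measurable_thickening (L : set 'rV[R]_k) (r : R) :
  measurable (thickening L r : set (borel_row R k)).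
Proof.
rewrite -[X in measurable X]setCK; apply: measurableC; apply: measurable_open_rV.
have -> : ~` thickening L r = edist_inf L @^-1` [set y | (r%:E < y)%E].
  by apply/seteqP; split => y /=; rewrite /thickening /= ltNge => /negP.
apply: open_comp; last exact: open_ereal_gt_ereal.
by move=> y _; exact: edist_inf_continuous.
Qed.

End Slab.

Section BallCover.
Context {R : realType} {T : pseudoMetricType R}.
Implicit Types (E : set T) (r s N B : R).

Definition ball_cover_le r N E : Prop :=
  exists l : seq T, [/\ forall y, y \in l -> E y,
    forall x, E x -> exists2 y, y \in l & ball y r x & (size l)%:R <= N].

Lemma ball_cover_le_bind r s N B E : 0 <= B ->
  ball_cover_le r N E ->
  (forall x, E x -> ball_cover_le s B (E `&` ball x r)) ->
  ball_cover_le s (N * B) E.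
Proof.
move=> B0 [l [lE Ecov lN]] local_cover.
have local_list x : exists lx : seq T, E x ->
    [/\ forall y, y \in lx -> (E `&` ball x r) y,
      forall z, (E `&` ball x r) z -> exists2 y, y \in lx & ball y s z & (size lx)%:R <= B].
  have [/local_cover[lx lx_cover]|notEx] := pselect (E x); first by exists lx.
  by exists [::].
have [f f_cover] := choice local_list.
exists (flatten (map f l)); split.
- move=> y /flattenP[_ /mapP[x xl ->]].
  by have [+ _ _] := f_cover x (lE x xl) => /[apply] -[].
- move=> z Ez; have [x xl xz] := Ecov z Ez.
  have [_ /(_ z (conj Ez xz))[y yf yz] _] := f_cover x (lE x xl).
  by exists y => //; apply/flattenP; exists (f x) => //; exact: map_f.
apply: le_trans (ler_wpM2r B0 lN); elim: l lE {Ecov lN} => [|x l IH] lE /=.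
  by rewrite mul0r.
have [_ _ fB] := f_cover x (lE x (mem_head x l)).
rewrite size_cat natrD -natr1 mulrDl mul1r addrC lerD// IH// => y yl.
by apply: lE; rewrite inE yl orbT.
Qed.

End BallCover.

Section Packing.
Context {R : realType} {k : nat} (mu : {measure set (borel_row R k) -> \bar R}).

Lemma separated_balls_measure (r m : R) (l : seq 'rV[R]_k) :
  (forall y, y \in l -> (m%:E <= mu (ball y (r / 2)%R))%E) ->
  pairwise (fun x y => r <= `|x - y|) l ->
  (((size l)%:R * m)%:E <= mu (\bigcup_(y in [set` l]) ball y (r / 2)%R))%E.
Proof.
elim: l => [|x l IH] ballm /=; first by rewrite mul0r measure_ge0.
move=> /andP[xl sep]; have -> : \bigcup_(y in [set` (x :: l)]) ball y (r / 2) =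
    ball x (r / 2) `|` \bigcup_(y in [set` l]) ball y (r / 2).
  apply/seteqP; split => z /=.
    by move=> [y]; rewrite /= inE => /orP[/eqP ->|yl] yz; [left|right; exists y].
  by move=> [xz|[y yl yz]]; [exists x|exists y] => //=; rewrite inE ?eqxx ?yl ?orbT.
rewrite measureU; first last.
- rewrite -subset0 => z [xz [y /= yl yz]].
  have := allP xl _ yl; rewrite leNgt => /negP; apply.
  move: xz yz; rewrite -!ball_normE /= => xz yz.
  by rewrite (le_lt_trans (ler_distD z _ _))// [ltRHS]splitr ltrD// distrC.
- by apply: measurable_open_rV; apply: bigcup_open => y _; exact: ball_open.
- exact: measurable_ball_rV.
rewrite -natr1 mulrDl mul1r addrC EFinD; apply: leeD.
  by apply: ballm; rewrite inE eqxx.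
by apply: IH => // y yl; apply: ballm; rewrite inE yl orbT.
Qed.

Lemma packing_cover (r m M : R) (E : set 'rV[R]_k) (G : set (borel_row R k)) :
  0 < r -> 0 < m -> measurable G -> (mu G <= M%:E)%E ->
  (forall y, E y -> ball y (r / 2) `<=` G /\ (m%:E <= mu (ball y (r / 2)%R))%E) ->
  ball_cover_le r (M / m) E.
Proof.
move=> r0 m0 mG GM ballE.
pose separated l := (forall y, y \in l -> E y) /\ pairwise (fun x y => r <= `|x - y|) l.
have size_le l : separated l -> (size l)%:R <= M / m.
  move=> [lE sep]; rewrite ler_pdivlMr// -lee_fin; apply: le_trans GM.
  apply: le_trans (separated_balls_measure _ sep) _; first by move=> y /lE/ballE[].
  apply: le_measure; rewrite ?inE//; last by move=> z [y /= /lE/ballE[yG _]] /yG.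
  by apply: measurable_open_rV; apply: bigcup_open => y _; exact: ball_open.
pose Q n := `[< exists2 l, separated l & size l = n >].
have Q0 : exists n, Q n.
  by exists 0%N; apply/asboolP; exists [::] => //; split.
have Qb n : Q n -> (n <= Num.truncn (M / m))%N.
  move=> /asboolP[l /size_le lM <-]; rewrite truncn_ge_nat//.
  exact: le_trans lM.
have [n /asboolP[l sep_l <-] nmax] := ex_maxnP Q0 Qb.
exists l; split; [exact: sep_l.1| |exact: size_le].
move=> x Ex; apply: contrapT => x_far.
suff /nmax : Q (size l).+1 by rewrite ltnn.
apply/asboolP; exists (x :: l) => //; split.
  by move=> y; rewrite inE => /orP[/eqP ->//|]; exact: sep_l.1.
rewrite /= sep_l.2 andbT; apply/allP => y yl; rewrite leNgt; apply/negP => xy.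
by apply: x_far; exists y => //; rewrite -ball_normE /= distrC.
Qed.

End Packing.

Section FlatSets.
Context {R : realType} {k : nat}.
Implicit Types (E : set 'rV[R]_k) (r t K rho eps tau : R).

Definition flat_at r t E : Prop := forall x, E x ->
  exists2 a : 'rV[R]_k, a != 0 & exists b, forall u, E u -> ball x r u ->
    `|dot a u - b| <= t * `|a|.

Lemma flat_atW E r t t' : t <= t' -> flat_at r t E -> flat_at r t' E.
Proof.
move=> tt flat x /flat[a a0 [b slab]]; exists a => //; exists b => u Eu ub.
by apply: le_trans (slab u Eu ub) _; rewrite ler_wpM2r.
Qed.

(* With ratio eps >= rho, the quadratic error r^2 at one scale is at most the
   next scale. *)
Lemma flat_at_geometric E rho eps tau K m : 0 < rho -> 0 < K ->
  rho <= eps <= 1 -> eps ^+ m * rho = tau ->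
  (forall r, tau <= r <= rho -> flat_at r (K * (tau + r ^+ 2)) E) ->
  forall j, (j < m)%N -> flat_at (eps ^+ j * rho) (2 * K * (eps ^+ j.+1 * rho)) E.
Proof.
move=> rho0 K0 /andP[rho_eps e1] <- flat j jm.
have e0 : 0 < eps by apply: lt_le_trans rho_eps.
have ej0 : 0 < eps ^+ j by rewrite exprn_gt0.
have ej1 : eps ^+ j <= 1 by rewrite exprn_ile1// ltW.
have tau_le : eps ^+ m * rho <= eps ^+ j.+1 * rho.
  by rewrite ler_pM2r// ler_wiXn2l// ltW.
apply: flat_atW (flat (eps ^+ j * rho) _); last first.
  by rewrite (le_trans tau_le) ?ler_pM2r ?exprS ?ler_piMl ?(ltW rho0) ?(ltW ej0).
rewrite (mulrC 2 K) -mulrA ler_pM2l// mulr_natl mulr2n lerD//.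
rewrite expr2 exprS -[leRHS]mulrA ler_pM2r ?mulr_gt0// (le_trans _ rho_eps)//.
by rewrite ler_piMl// ltW.
Qed.

End FlatSets.

Section DecayAndRegularity.
Context {R : realType} {k : nat} (mu : {measure set (borel_row R k) -> \bar R}).

Definition decaying_below (alpha Cd rho0 : R) : Prop :=
  forall (rho : R) (x : 'rV[R]_k) (L : set 'rV[R]_k) (eps : R),
    0 < rho <= rho0 -> measure_support mu x -> affine_hyperplane L -> 0 < eps ->
    (mu (ball x rho `&` thickening L (eps * rho)) <=
       (Cd * eps `^ alpha)%:E * mu (ball x rho))%E.

Definition regular_below (delta C rho0 : R) : Prop :=
  forall (x : 'rV[R]_k) (rho : R), measure_support mu x -> 0 < rho <= rho0 ->
    ((C^-1 * rho `^ delta)%:E <= mu (ball x rho))%E /\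
    (mu (ball x rho) <= (C * rho `^ delta)%:E)%E.

Lemma decaying_belowW alpha Cd rho0 rho1 : rho1 <= rho0 ->
  decaying_below alpha Cd rho0 -> decaying_below alpha Cd rho1.
Proof.
move=> r10 decay rho x L eps /andP[rho_gt0 rho_le]; apply: decay.
by rewrite rho_gt0 (le_trans rho_le).
Qed.

Lemma regular_belowW delta C rho0 rho1 : rho1 <= rho0 ->
  regular_below delta C rho0 -> regular_below delta C rho1.
Proof.
move=> r10 regular x rho sx /andP[rho_gt0 rho_le]; apply: regular => //.
by rewrite rho_gt0 (le_trans rho_le).
Qed.

Lemma decaying_regular_common_scale alpha delta :
  absolutely_decaying alpha mu -> ahlfors_regular delta mu ->
  exists rho0 Cd C, [/\ 0 < rho0, 0 < Cd, 1 <= C &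
    decaying_below alpha Cd rho0 /\ regular_below delta C rho0].
Proof.
move=> [_ [rd [Cd [rd0 Cd0 decay]]]] [ra [C [ra0 C1 regular]]].
exists (Num.min rd ra), Cd, C; split=> //; first by rewrite lt_min rd0.
split; first by apply: decaying_belowW decay; rewrite ge_min lexx.
by apply: regular_belowW regular; rewrite ge_min lexx orbT.
Qed.

End DecayAndRegularity.

Lemma powR_lower_bound_le0 {R : realType} (K x : R) :
  (forall eps, 0 < eps <= 1 -> 1 <= K * eps `^ x) -> x <= 0.
Proof.
move=> lower; rewrite leNgt; apply/negP => x0.
have K1 : 1 <= K by have := lower 1; rewrite powR1 mulr1 ltr01 lexx; apply.
have K0 : 0 < K by apply: lt_le_trans K1.
have := lower ((2 * K)^-1 `^ x^-1); rewrite -powRrM mulVf ?gt_eqF// powRr1; last first.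
  by rewrite invr_ge0 mulr_ge0// ltW.
rewrite invfM mulrCA mulfV ?gt_eqF// mulr1 => half1.
suff : (1 : R) <= 2^-1 by lra.
apply: half1; apply/andP; split; first by rewrite powR_gt0// mulr_gt0 ?invr_gt0.
apply: (@le_trans _ _ (1 `^ x^-1)); last by rewrite powR1.
apply: ge0_ler_powR.
- by rewrite invr_ge0 ltW.
- by rewrite nnegrE mulr_ge0// invr_ge0// ltW.
- by rewrite nnegrE.
by rewrite mulr_ile1 ?invr_ge0 ?invf_le1 ?(ltW K0) ?ler1n.
Qed.

Section Scales.
Context {R : realType} {k : nat} (mu : {measure set (borel_row R k) -> \bar R}).
Context (alpha delta rho0 Cd C : R).
Hypotheses (rho0_gt0 : 0 < rho0) (Cd_gt0 : 0 < Cd) (C_ge1 : 1 <= C).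
Hypothesis decay : decaying_below mu alpha Cd rho0.
Hypothesis regular : regular_below mu delta C rho0.

Let C_gt0 : 0 < C. Proof. exact: lt_le_trans C_ge1. Qed.

Lemma decay_regular_ratio (x : 'rV[R]_k) (eps : R) :
  (0 < k)%N -> measure_support mu x -> 0 < eps <= 1 ->
  1 <= C * C * Cd * eps `^ (alpha - delta).
Proof.
move=> k0 sx /andP[e0 e1]; pose i := Ordinal k0.
pose L : set 'rV[R]_k := [set y | dot (delta_mx ord0 i) y = x ord0 i].
have delta0 : delta_mx ord0 i != 0 :> 'rV[R]_k.
  by rewrite -normr_gt0 norm_delta_row.
have eps_itv : 0 < eps * rho0 <= rho0 by rewrite mulr_gt0//= ler_piMl// ltW.
have rho0_itv : 0 < rho0 <= rho0 by rewrite rho0_gt0/=.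
have ball_sub : ball x (eps * rho0) `<=` ball x rho0 `&` thickening L (eps * rho0).
  move=> y xy; split; first by apply: le_ball xy; case/andP: eps_itv.
  apply: slab_thickening => //; rewrite norm_delta_row mulr1 dotC dot_delta.
  apply: le_trans (_ : `|y - x| <= _); last first.
    by move: xy; rewrite -ball_normE /= distrC => /ltW.
  by have := ler_coord_norm (y - x) i; rewrite !mxE.
have : ((C^-1 * (eps * rho0) `^ delta)%:E <=
    (Cd * eps `^ alpha * (C * rho0 `^ delta))%:E)%E.
  apply: le_trans (regular sx eps_itv).1 _.
  apply: (@le_trans _ _ (mu (ball x rho0 `&` thickening L (eps * rho0)))).
    apply: le_measure => //; rewrite inE; first exact: measurable_ball_rV.
    by apply: measurableI; [exact: measurable_ball_rV|exact: measurable_thickening].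
  apply: le_trans (decay rho0_itv sx (affine_hyperplane_dot _ delta0) e0) _.
  rewrite [leRHS]EFinM; apply: lee_wpmul2l (regular sx rho0_itv).2.
  by rewrite lee_fin mulr_ge0 ?powR_ge0// ltW.
rewrite lee_fin powRM ?(ltW e0) ?(ltW rho0_gt0)// !mulrA.
rewrite ler_pM2r ?powR_gt0// ler_pdivrMl// => ratio.
rewrite powRB; last by rewrite (gt_eqF e0) implybT.
rewrite mulrA ler_pdivlMr ?powR_gt0// mul1r; apply: le_trans ratio _.
by rewrite [leLHS](_ : _ = C * C * Cd * eps `^ alpha)//; ring.
Qed.

Lemma decay_exponent_le_dimension (x : 'rV[R]_k) :
  (0 < k)%N -> measure_support mu x -> alpha <= delta.
Proof.
move=> k0 sx; rewrite -subr_le0.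
by apply: powR_lower_bound_le0 => eps; exact: decay_regular_ratio k0 sx.
Qed.

Lemma regular_packing (E G : set 'rV[R]_k) (r s theta : R) :
  E `<=` measure_support mu -> 0 < s <= r -> r <= rho0 ->
  measurable (G : set (borel_row R k)) ->
  (forall y, E y -> ball y (s / 2) `<=` G) ->
  (mu G <= (theta * (C * (2 * r) `^ delta))%:E)%E ->
  ball_cover_le s (theta * (C * C * 4 `^ delta * (r / s) `^ delta)) E.
Proof.
move=> Esupp /andP[s0 sr] r_le mG EG Gle.
have r0 : 0 < r by apply: lt_le_trans sr.
have s2 : 0 < s / 2 <= rho0 by rewrite divr_gt0//=; lra.
pose m := C^-1 * (s / 2) `^ delta.
have m0 : 0 < m by rewrite mulr_gt0 ?invr_gt0// powR_gt0//; case/andP: s2.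
have -> : theta * (C * C * 4 `^ delta * (r / s) `^ delta) =
    theta * (C * (2 * r) `^ delta) / m.
  have -> : (2 * r) `^ delta = 4 `^ delta * (r / s) `^ delta * (s / 2) `^ delta.
    rewrite -!powRM ?mulr_ge0 ?divr_ge0 ?invr_ge0 ?(ltW s0) ?(ltW r0)//.
    by congr (_ `^ _); field; rewrite gt_eqF.
  by rewrite /m; field; rewrite !gt_eqF// powR_gt0//; case/andP: s2.
apply: packing_cover Gle _ => // y Ey; split; first exact: EG.
by apply: (regular _ s2).1; exact: Esupp.
Qed.

Lemma ball_cover_in_ball (E : set 'rV[R]_k) (u0 : 'rV[R]_k) (r s : R) :
  E `<=` measure_support mu -> measure_support mu u0 -> E `<=` ball u0 r ->
  2 * r <= rho0 -> 0 < s <= r ->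
  ball_cover_le s (C * C * 4 `^ delta * (r / s) `^ delta) E.
Proof.
move=> Esupp su0 Er two_r_le /andP[s0 sr]; have r0 : 0 < r by apply: lt_le_trans sr.
rewrite -[_ * _]mul1r; apply: (regular_packing (G := ball u0 (2 * r))) => //.
- by rewrite s0.
- by lra.
- exact: measurable_ball_rV.
- move=> y /Er; rewrite -!ball_normE /= => u0y z /= yz.
  by apply: le_lt_trans (ler_distD y _ _) _; lra.
by rewrite mul1r; apply: (regular su0 _).2; rewrite mulr_gt0//=.
Qed.

Definition refine_const (K : R) : R :=
  Cd * ((2 * K + k%:R) / 4) `^ alpha * (C * C * 4 `^ delta).

Lemma refine_const_ge0 K : 0 <= refine_const K.
Proof. by rewrite /refine_const !mulr_ge0 ?powR_ge0// ltW. Qed.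

Lemma ball_cover_in_slab (E : set 'rV[R]_k) (r eps K : R) (x : 'rV[R]_k) :
  E `<=` measure_support mu -> 0 < K -> 0 < r -> 2 * r <= rho0 -> 0 < eps <= 1 ->
  flat_at r (K * (eps * r)) E -> E x ->
  ball_cover_le (eps * r) (refine_const K * eps `^ (alpha - delta)) (E `&` ball x r).
Proof.
move=> Esupp K0 r0 two_r_le /andP[e0 e1] flat Ex; have [a a0 [b slab]] := flat x Ex.
have er0 : 0 < eps * r by rewrite mulr_gt0.
have er1 : eps * r <= r by rewrite ler_piMl// ltW.
pose c := (2 * K + k%:R) / 4.
have c0 : 0 < c by rewrite divr_gt0// ltr_pwDl// mulr_gt0.
pose L := [set y | dot a y = b].
pose theta := Cd * (c * eps) `^ alpha.
have -> : refine_const K * eps `^ (alpha - delta) =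
    theta * (C * C * 4 `^ delta * (r / (eps * r)) `^ delta).
  have -> : r / (eps * r) = eps^-1 by field; rewrite !gt_eqF.
  rewrite powRB; last by rewrite (gt_eqF e0) implybT.
  rewrite -[eps^-1](powR_inv1 (ltW e0)) -powRrM mulN1r powRN.
  rewrite /theta powRM ?(ltW c0) ?(ltW e0)//.
  by rewrite /refine_const -/c; ring.
apply: (regular_packing (G := ball x (2 * r) `&` thickening L (c * eps * (2 * r)))).
- by move=> u [/Esupp].
- by rewrite er0.
- by lra.
- by apply: measurableI; [exact: measurable_ball_rV|exact: measurable_thickening].
- move=> y [Ey xy]; rewrite subsetI; split.
    move: xy; rewrite -!ball_normE /= => xy u /= yu.
    by apply: le_lt_trans (ler_distD y _ _) _; lra.
  have := slab_ball_thickening (s := eps * r / 2) a0 (slab y Ey xy).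
  by congr (_ `<=` thickening _ _); rewrite /c; field.
have two_r_itv : 0 < 2 * r <= rho0 by rewrite mulr_gt0.
have ce0 : 0 < c * eps by rewrite mulr_gt0.
apply: le_trans (decay two_r_itv (Esupp _ Ex) (affine_hyperplane_dot b a0) ce0) _.
rewrite [leRHS]EFinM; apply: lee_wpmul2l (regular (Esupp _ Ex) two_r_itv).2.
by rewrite lee_fin mulr_ge0 ?powR_ge0// ltW.
Qed.

Lemma ball_cover_refine (E : set 'rV[R]_k) (r eps K N : R) (m : nat) :
  E `<=` measure_support mu -> 0 < K -> 0 < r -> 2 * r <= rho0 -> 0 < eps <= 1 ->
  (forall j, (j < m)%N -> flat_at (eps ^+ j * r) (K * (eps ^+ j.+1 * r)) E) ->
  ball_cover_le r N E ->
  ball_cover_le (eps ^+ m * r) (N * (refine_const K * eps `^ (alpha - delta)) ^+ m) E.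
Proof.
move=> Esupp K0 r0 two_r_le e01 + Ecov; have /andP[e0 e1] := e01.
elim: m => [|m IH] flat; first by rewrite !expr0 mul1r mulr1.
have em0 : 0 < eps ^+ m * r by rewrite mulr_gt0 ?exprn_gt0.
have em_le : 2 * (eps ^+ m * r) <= rho0.
  apply: le_trans two_r_le; rewrite ler_pM2l// ler_piMl ?(ltW r0)//.
  by rewrite exprn_ile1// ltW.
rewrite exprS -mulrA exprSr [N * _]mulrA; apply: ball_cover_le_bind.
- by rewrite mulr_ge0 ?refine_const_ge0 ?powR_ge0.
- by apply: IH => j jm; apply: flat; exact: ltnW.
move=> x Ex; apply: ball_cover_in_slab => //.
by rewrite [eps * _]mulrA -exprS; exact: flat.
Qed.

(* The scales rho, rho^(1+g), rho^(1+2g), ..., rho^c with g <= 1: their number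
   depends on c only. *)
Lemma multiscale_cover (c K rad : R) : 1 <= c -> 0 < K -> 0 < rad -> 2 * rad <= rho0 ->
  exists A : R, forall (E : set 'rV[R]_k) (u0 : 'rV[R]_k) (rho : R),
    E `<=` measure_support mu -> measure_support mu u0 -> E `<=` ball u0 rad ->
    0 < rho <= rad -> rho <= 1 ->
    (forall r, rho `^ c <= r <= rho -> flat_at r (K * (rho `^ c + r ^+ 2)) E) ->
    ball_cover_le (rho `^ c) (A * rho `^ ((c - 1) * alpha - c * delta)) E.
Proof.
move=> c1 K0 rad0 two_r_le.
pose m := (Num.truncn (c - 1)).+1; pose g := (c - 1) / m%:R.
have g0 : 0 <= g by rewrite divr_ge0 ?subr_ge0// ltW.
have g1 : g <= 1 by rewrite ler_pdivrMr// mul1r ltW// truncnS_gt.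
have gm : g * m%:R = c - 1 by rewrite divfK// gt_eqF.
pose B := refine_const (2 * K).
exists (C * C * 4 `^ delta * rad `^ delta * B ^+ m).
move=> E u0 rho Esupp su0 Erad rho_itv rho_le1 flat.
have /andP[rho_gt0 rho_rad] := rho_itv.
have rho01 : 0 < rho <= 1 by rewrite rho_gt0.
pose eps := rho `^ g.
have e01 : 0 < eps <= 1 by rewrite powR_gt0//= -(powRr0 rho) ger_powR.
have rho_eps : rho <= eps <= 1.
  by case/andP: e01 => _ ->; rewrite andbT -{1}(powRr1 (ltW rho_gt0)) ger_powR.
have epsm : eps ^+ m * rho = rho `^ c.
  rewrite -powR_mulrn ?powR_ge0// -powRrM gm -{2}(powRr1 (ltW rho_gt0)).
  by rewrite -powRD ?subrK// (gt_eqF rho_gt0) implybT.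
have flat_eps := flat_at_geometric rho_gt0 K0 rho_eps epsm flat.
have := ball_cover_in_ball Esupp su0 Erad two_r_le rho_itv.
move=> /(ball_cover_refine Esupp _ rho_gt0 _ e01 flat_eps).
rewrite epsm mulr_gt0// (le_trans _ two_r_le) ?ler_pM2l// => /(_ isT isT).
congr ball_cover_le.
have -> : (rad / rho) `^ delta = rad `^ delta * rho `^ (- delta).
  rewrite powRM ?invr_ge0 ?(ltW rad0) ?(ltW rho_gt0)//.
  by rewrite -[rho^-1]powR_inv1 ?(ltW rho_gt0)// -powRrM mulN1r.
have -> : (B * eps `^ (alpha - delta)) ^+ m = B ^+ m * rho `^ ((c - 1) * (alpha - delta)).
  rewrite exprMn -[X in _ * X]powR_mulrn ?powR_ge0// -!powRrM -gm.
  by congr (_ * _ `^ _); ring.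
have -> : (c - 1) * alpha - c * delta = - delta + (c - 1) * (alpha - delta) by ring.
rewrite [in RHS]powRD; last by rewrite (gt_eqF rho_gt0) implybT.
by ring.
Qed.

End Scales.

(** * Flatness near the rational points *)

Section ChartFlat.
Context {R : realType} {k d : nat}.
Implicit Types (psi : 'rV[R]_k -> 'rV[R]_d).

Definition near_rational_zeros (P : mpoly d int) psi (Q tau : R) : set 'rV[R]_k :=
  [set u | exists2 z, rational_zeros P Q z & `|psi u - z| <= tau].

Definition flat_near_rational_zeros (P : mpoly d int) psi (A : set 'rV[R]_k)
    (K kap : R) : Prop :=
  forall (E : set 'rV[R]_k) (Q tau r : R),
    E `<=` A -> E `<=` near_rational_zeros P psi Q tau ->
    0 <= tau <= r -> 0 < r <= kap -> r * Q <= kap -> flat_at r (K * (tau + r ^+ 2)) E.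

Lemma local_chart_expansion (U : set 'rV[R]_k) (M : set 'rV[R]_d) psi (u0 : 'rV[R]_k) :
  local_chart U M psi -> U u0 ->
  exists r L eta K (g : 'rV[R]_d -> 'rV[R]_k), [/\ 0 < r, 0 < L, 0 < eta, 0 < K &
    [/\ L.-lipschitz_(ball u0 r) psi,
      forall u, ball u0 r u -> ball (psi u0) (eta / 2) (psi u) /\ g (psi u) = u &
      taylor2_le K (ball (psi u0) eta) g]].
Proof.
move=> [oU psi_smooth _ [phi phiK phi_smooth]] Uu0.
have [V [g [oV Vu0 g_smooth gphi]]] := phi_smooth (psi u0) (imageP _ Uu0).
have [eta [K [eta0 K0 etaV gtaylor]]] := C2_expansion oV Vu0 (g_smooth 2%N).
have [r0 [L [r00 L0 r0U [/klipschitzP psi_lip _]]]] :=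
  C2_expansion oU Uu0 (psi_smooth 2%N).
pose r := Num.min r0 (eta / 2 / L).
have r_gt0 : 0 < r by rewrite lt_min r00 !divr_gt0.
have sub0 : ball u0 r `<=` ball u0 r0 by apply: le_ball; rewrite ge_min lexx.
have lip u v : ball u0 r u -> ball u0 r v -> `|psi u - psi v| <= L * `|u - v|.
  by move=> /sub0 ub /sub0; exact: psi_lip.
exists r, L, eta, K, g; split=> //; split=> // [|u ub]; first exact/klipschitzP.
have psi_near : ball (psi u0) (eta / 2) (psi u).
  rewrite -ball_normE /=; apply: le_lt_trans (lip u0 u (ballxx _ r_gt0) ub) _.
  rewrite mulrC -ltr_pdivlMr//; move: ub; rewrite -ball_normE /= => /lt_le_trans; apply.
  by rewrite ge_min lexx orbT.
have Uu : U u by apply: r0U; exact: sub0.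
split=> //; rewrite gphi ?phiK//; apply: etaV; apply: le_ball psi_near.
by rewrite ler_pdivrMr// ler_peMr ?ler1n// ltW.
Qed.

Section LocalExpansion.
Context (rad L eta K : R) (psi : 'rV[R]_k -> 'rV[R]_d) (g : 'rV[R]_d -> 'rV[R]_k).
Context (u0 : 'rV[R]_k).
Hypotheses (L_gt0 : 0 < L) (K_gt0 : 0 < K).
Hypothesis lip : L.-lipschitz_(ball u0 rad) psi.
Hypothesis psi_near : forall u, ball u0 rad u ->
  ball (psi u0) (eta / 2) (psi u) /\ g (psi u) = u.
Hypothesis expansion : taylor2_le K (ball (psi u0) eta) g.

Lemma near_image_ball u z : ball u0 rad u -> `|psi u - z| <= eta / 2 ->
  ball (psi u0) eta z.
Proof.
move=> /psi_near[+ _] uz; rewrite -!ball_normE /= => u0u.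
by apply: le_lt_trans (ler_distD (psi u) _ _) _; rewrite [ltRHS]splitr ltr_leD.
Qed.

Lemma near_image_dist_le x r u v z w :
  ball u0 rad u -> ball u0 rad v -> ball x r u -> ball x r v ->
  `|psi u - z| <= r -> `|psi v - w| <= r -> `|z - w| <= (2 + 2 * L) * r.
Proof.
move=> u0u u0v xu xv uz vw.
have uv : `|u - v| <= 2 * r.
  move: xu xv; rewrite -!ball_normE /= => xu xv.
  by apply: le_trans (ler_distD x _ _) _; rewrite (distrC u x); lra.
have psi_uv : `|psi u - psi v| <= L * (2 * r).
  by apply: le_trans ((klipschitzP _ _ _).1 lip u v u0u u0v) _; rewrite ler_pM2l.
apply: le_trans (ler_distD (psi u) _ _) _; rewrite (distrC z).
by have := ler_distD (psi v) (psi u) w; lra.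
Qed.

Lemma near_image_slab u z z0 (a : 'cV[R]_k) tau s :
  ball u0 rad u -> `|psi u - z| <= tau -> tau <= eta / 2 ->
  ball (psi u0) eta z0 -> `|z - z0| <= s -> (z - z0) *m partial_mx g z0 *m a = 0 ->
  `|dot a^T u - dot a^T (g z0)| <= k%:R * (K * (tau + s ^+ 2)) * `|a^T|.
Proof.
move=> u0u uz tau_eta z0_near zz0 conormal.
have [/klipschitzP g_lip g_taylor] := expansion.
have z_near : ball (psi u0) eta z by apply: near_image_ball u0u (le_trans uz tau_eta).
have [_ gu] := psi_near u0u.
have psiu_ball : ball (psi u0) eta (psi u).
  apply: (near_image_ball u0u).
  by rewrite subrr normr0 (le_trans _ tau_eta)// (le_trans _ uz).
have ugz : `|u - g z| <= K * tau.
  rewrite -[X in X - _]gu; apply: le_trans (g_lip _ _ psiu_ball z_near) _.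
  by rewrite ler_pM2l.
have gzz0 : `|g z - g z0 - (z - z0) *m partial_mx g z0| <= K * s ^+ 2.
  apply: le_trans (g_taylor _ _ z0_near z_near) _.
  by rewrite ler_pM2l// lerXn2r ?nnegrE// (le_trans _ zz0).
rewrite -dotB.
have -> : u - g z0 = (u - g z) + (g z - g z0 - (z - z0) *m partial_mx g z0)
    + (z - z0) *m partial_mx g z0 by rewrite addrA subrK addrA subrK.
rewrite dotD [X in _ + X]dot_mulmx conormal [X in _ + X]mxE addr0.
apply: le_trans (dot_norm_le _ _) _; rewrite mulrAC ler_wpM2r// ler_wpM2l//.
by rewrite mulrDr; apply: le_trans (ler_normD _ _) (lerD ugz gzz0).
Qed.

Lemma near_rational_zeros_flat_of_span (P : mpoly d int) (E : set 'rV[R]_k) Q tau r :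
  (d <= k.+1)%N -> E `<=` ball u0 rad -> E `<=` near_rational_zeros P psi Q tau ->
  0 < r -> tau <= r -> r <= eta / 2 ->
  (forall T : set 'rV[R]_d, T `<=` rational_zeros P Q ->
    (forall z w, T z -> T w -> `|z - w| <= (2 + 2 * L) * r) -> affine_codim_ge2 T) ->
  flat_at r (k%:R * (K * (tau + ((2 + 2 * L) * r) ^+ 2))) E.
Proof.
move=> dk Erad Enear r0 tau_r r_eta span x Ex; have tau_eta := le_trans tau_r r_eta.
pose T : set 'rV[R]_d := [set z | rational_zeros P Q z /\
  exists u, [/\ E u, ball x r u & `|psi u - z| <= tau]].
have T_diam z w : T z -> T w -> `|z - w| <= (2 + 2 * L) * r.
  move=> [_ [u [Eu xu uz]]] [_ [v [Ev xv vw]]].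
  by apply: (near_image_dist_le (Erad _ Eu) (Erad _ Ev) xu xv); exact: le_trans tau_r.
have [z0 Tz0] : T !=set0.
  have [z Pz xz] := Enear _ Ex; exists z; split=> //; exists x; split=> //.
  exact: ballxx.
have T_span : affine_codim_ge2 T by apply: span => // z [].
have [a a0 conormal] := affine_codim_ge2_conormal (partial_mx g z0) dk T_span Tz0.
exists a^T; first by rewrite trmx_eq0.
exists (dot a^T (g z0)) => u Eu xu; have [z Pz uz] := Enear _ Eu.
have Tz : T z by split=> //; exists u.
apply: (near_image_slab (Erad _ Eu) uz tau_eta _ (T_diam _ _ Tz Tz0) (conormal z Tz)).
have [_ [v [Ev _ vz0]]] := Tz0.
by apply: (near_image_ball (Erad _ Ev)); exact: le_trans tau_eta.
Qed.

End LocalExpansion.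

Lemma near_rational_zeros_flat (P : mpoly d int) (U : set 'rV[R]_k) (M : set 'rV[R]_d)
    psi (u0 : 'rV[R]_k) :
  (d <= k.+1)%N -> quadratic P -> irreducible_over_rat P -> local_chart U M psi -> U u0 ->
  exists rad L K kap : R, [/\ 0 < rad, 0 < L, 0 < K, 0 < kap &
    L.-lipschitz_(ball u0 rad) psi /\
    flat_near_rational_zeros P psi (ball u0 rad) K kap].
Proof.
move=> dk quadP irrP chart Uu0.
have [rad [L [eta [K2 [g [rad0 L0 eta0 K20 [lip psi_near expansion]]]]]]] :=
  local_chart_expansion chart Uu0.
have [kappa kappa0 span] := rational_zeros_span (R := R) quadP irrP.
pose A := 2 + 2 * L; have A0 : 0 < A by rewrite addr_gt0// mulr_gt0.
pose kap := Num.min (eta / 2) (kappa / A).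
have kap0 : 0 < kap by rewrite lt_min !divr_gt0.
pose K := k%:R * (K2 * (1 + A ^+ 2)) + 1.
have K0 : 0 < K by rewrite ltr_wpDl// !mulr_ge0 ?(ltW K20)// addr_ge0// exprn_ge0// ltW.
exists rad, L, K, kap; split=> //; split=> // E Q tau r Erad Enear.
move=> /andP[tau0 tau_r] /andP[r0]; rewrite /kap le_min => /andP[r_eta _].
rewrite le_min => /andP[_]; rewrite ler_pdivlMr// mulrC mulrA => rQ.
apply: (flat_atW (t := k%:R * (K2 * (tau + (A * r) ^+ 2)))); last first.
  apply: (near_rational_zeros_flat_of_span L0 K20 lip psi_near expansion dk Erad Enear
    r0 tau_r r_eta).
  move=> T TP T_diam; apply: (span Q T TP) => z w Tz Tw.
  apply: le_trans rQ; rewrite ler_wpM2r ?T_diam//.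
  by have [p [q [_ qQ _]]] := (TP _ Tz).2; exact: le_trans qQ.
have r20 : 0 <= r ^+ 2 := sqr_ge0 r.
apply: (@le_trans _ _ (k%:R * (K2 * (1 + A ^+ 2)) * (tau + r ^+ 2))); last first.
  by rewrite /K [leRHS]mulrDl mul1r lerDl addr_ge0.
have -> : k%:R * (K2 * (tau + (A * r) ^+ 2)) =
    k%:R * (K2 * (1 + A ^+ 2)) * (tau + r ^+ 2)
      - k%:R * K2 * (A ^+ 2 * tau + r ^+ 2) by ring.
by rewrite gerBl !mulr_ge0 ?addr_ge0 ?mulr_ge0 ?sqr_ge0// ltW.
Qed.

End ChartFlat.

(** * Hausdorff measure *)

Lemma nneseries_pair {R : realType} (a : nat -> nat -> \bar R) (f : nat -> nat * nat) :
  (forall n i, (0 <= a n i)%E) -> set_bij [set: nat] [set: nat * nat] f ->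
  (\sum_(0 <= n <oo) \sum_(0 <= i <oo) a n i = \sum_(0 <= j <oo) a (f j).1 (f j).2)%E.
Proof.
move=> a0 bij_f; rewrite [RHS]nneseries_esumT// nneseries_esumT; last first.
  by move=> n; apply: nneseries_ge0 => i _ _.
rewrite (eq_esum (b := fun n => \esum_(i in [set: nat]) a n i)%E); last first.
  by move=> n _; rewrite nneseries_esumT.
rewrite esum_esum// (_ : _ `*`` _ = [set: nat * nat]); last by apply/seteqP; split.
exact: reindex_esum.
Qed.

Lemma nneseries_geometric {R : realType} (a x : R) : 0 <= x < 1 ->
  (\sum_(0 <= n <oo) (a * x ^+ n)%:E = (a / (1 - x))%:E)%E.
Proof.
move=> /andP[x0 x1]; apply: cvg_lim => //.
under eq_fun do rewrite sumEFin.
apply: cvg_EFin; first by near=> n.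
by apply: cvg_geometric_series; rewrite ger0_norm.
Unshelve. all: by end_near. Qed.

Section Hausdorff.
Context {R : realType} {d : nat}.
Implicit Types (A : set 'rV[R]_d) (s eps : R).

Lemma diameter_ge0 A : (0 <= diameter A)%E.
Proof. by apply: ereal_sup_ubound; left. Qed.

Lemma diameter_le A (r : R) : 0 <= r ->
  (forall x y, A x -> A y -> `|x - y| <= r) -> (diameter A <= r%:E)%E.
Proof.
move=> r0 Ar; apply: ge_ereal_sup => _ [->|[[x y] [/= Ax Ay] <-]].
  by rewrite lee_fin.
by rewrite lee_fin; exact: Ar.
Qed.

Lemma diameter_set0 : diameter (set0 : set 'rV[R]_d) = 0%E.
Proof. by apply/eqP; rewrite eq_le diameter_ge0 diameter_le. Qed.

Lemma hausdorff_premeasure_ge0 s eps A : (0 <= hausdorff_premeasure s eps A)%E.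
Proof.
apply: le_ereal_inf_tmp => _ [F _ <-].
by apply: nneseries_ge0 => n _ _; exact: poweR_ge0.
Qed.

Lemma le_hausdorff_premeasure s eps A B : A `<=` B ->
  (hausdorff_premeasure s eps A <= hausdorff_premeasure s eps B)%E.
Proof.
move=> AB; apply: le_ereal_inf_tmp => _ [F [BF Fd] <-]; apply: ereal_inf_lbound.
by exists F => //; split => //; exact: subset_trans BF.
Qed.

Lemma hausdorff_premeasure_adherent s eps A (e : R) : 0 < e ->
  hausdorff_premeasure s eps A <> +oo%E ->
  exists F : nat -> set 'rV[R]_d,
    (A `<=` \bigcup_i F i /\ forall i, (diameter (F i) <= eps%:E)%E) /\
    (\sum_(0 <= i <oo) diameter (F i) `^ s <= hausdorff_premeasure s eps A + e%:E)%E.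
Proof.
move=> e0 Aoo; have fin : hausdorff_premeasure s eps A \is a fin_num.
  by rewrite ge0_fin_numE ?hausdorff_premeasure_ge0// ltey; exact/eqP.
by have [_ [F FA <-] /ltW Fe] := lb_ereal_inf_adherent e0 fin; exists F.
Qed.

Lemma hausdorff_premeasure_bigcup s eps (A : nat -> set 'rV[R]_d) :
  (hausdorff_premeasure s eps (\bigcup_n A n) <=
     \sum_(0 <= n <oo) hausdorff_premeasure s eps (A n))%E.
Proof.
have [[i ioo]|] := pselect (exists i, hausdorff_premeasure s eps (A i) = +oo%E).
  rewrite (eseries_pinfty _ _ ioo) ?leey// => n _.
  by rewrite -ltNye (lt_le_trans _ (hausdorff_premeasure_ge0 _ _ _)).
rewrite -forallNE => Aoo; apply/lee_addgt0Pr => e e0.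
rewrite (le_trans _ (epsilon_trick _ _ (ltW e0)))//; last first.
  by move=> n; exact: hausdorff_premeasure_ge0.
have cover_near n : exists F : nat -> set 'rV[R]_d,
    (A n `<=` \bigcup_i F i /\ forall i, (diameter (F i) <= eps%:E)%E) /\
    (\sum_(0 <= i <oo) diameter (F i) `^ s <=
       hausdorff_premeasure s eps (A n) + (e / (2 ^ n.+1)%:R)%:E)%E.
  apply: hausdorff_premeasure_adherent (Aoo n).
  by rewrite divr_gt0// ltr0n expn_gt0.
have [G GA] := choice cover_near.
apply: (@le_trans _ _
  (\sum_(0 <= n <oo) \sum_(0 <= i <oo) diameter (G n i) `^ s)%E); last first.
  apply: lee_nneseries => n _; last exact: (GA n).2.
  by move=> _; apply: nneseries_ge0 => i _ _; exact: poweR_ge0.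
have /card_esym/ppcard_eqP[f] := card_nat2.
rewrite (nneseries_pair (f := f)); [|by move=> n i; exact: poweR_ge0|exact: 'bij_f].
apply: ereal_inf_lbound; exists (fun j => G (f j).1 (f j).2) => //.
split; last by move=> j; exact: (GA (f j).1).1.2.
move=> x [n _ /(GA n).1.1[i _ Gx]].
by exists (f^-1%FUN (n, i)) => //; rewrite invK ?inE.
Qed.

Lemma hausdorff_premeasure_seq s eps (r : R) A (l : seq (set 'rV[R]_d)) :
  0 < s -> 0 <= r <= eps -> (forall x, A x -> exists2 F, F \in l & F x) ->
  (forall F, F \in l -> (diameter F <= r%:E)%E) ->
  (hausdorff_premeasure s eps A <= ((size l)%:R * r `^ s)%:E)%E.
Proof.
move=> s0 /andP[r0 reps] Al dl; pose F i := nth set0 l i.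
have dF i : (diameter (F i) <= r%:E)%E.
  have [il|il] := ltnP i (size l); first by apply: dl; exact: mem_nth.
  by rewrite /F nth_default// diameter_set0 lee_fin.
apply: (@le_trans _ _ (\sum_(0 <= i <oo) diameter (F i) `^ s)%E).
  apply: ereal_inf_lbound; exists F => //; split.
    move=> x /Al[B Bl Bx]; exists (index B l) => //.
    by rewrite /F nth_index.
  by move=> i; apply: le_trans (dF i) _; rewrite lee_fin.
rewrite (nneseries_split 0 (size l)); last by move=> k _; exact: poweR_ge0.
rewrite add0n eseries0 ?adde0; last first.
  by move=> i il _; rewrite /F nth_default// diameter_set0 poweR0r ?gt_eqF.
apply: (@le_trans _ _ (\sum_(0 <= i < size l) (r `^ s)%:E)%E).
  apply: lee_sum => i _; rewrite -poweR_EFin.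
  apply: gt0_ler_poweR => //; rewrite ?(ltW s0)// in_itv/= leey andbT ?diameter_ge0//.
by rewrite sumEFin sumr_const_nat subn0 mulr_natl.
Qed.

Lemma hausdorff_premeasure_lipschitz_image {k : nat} s eps (f : 'rV[R]_k -> 'rV[R]_d)
    (E : set 'rV[R]_k) (L r N : R) :
  0 < s -> 0 < L -> 0 <= r -> 2 * L * r <= eps -> ball_cover_le r N E ->
  L.-lipschitz_E f ->
  (hausdorff_premeasure s eps (f @` E) <= (N * (2 * L * r) `^ s)%:E)%E.
Proof.
move=> s0 L0 r0 Lr_eps [l [lE Ecov lN]] /klipschitzP lip.
have Lr0 : 0 <= 2 * L * r by rewrite !mulr_ge0// ltW.
pose F y := f @` (E `&` ball y r).
apply: (@le_trans _ _ ((size (map F l))%:R * (2 * L * r) `^ s)%:E); last first.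
  by rewrite lee_fin size_map ler_wpM2r ?powR_ge0.
apply: hausdorff_premeasure_seq => //; first by rewrite Lr0.
  move=> _ [u Eu <-]; have [y yl yu] := Ecov u Eu.
  by exists (F y); [exact: map_f|exists u].
move=> _ /mapP[y yl ->]; apply: diameter_le => // _ _ [u [Eu yu] <-] [v [Ev yv] <-].
apply: le_trans (lip _ _ Eu Ev) _; rewrite (mulrC 2 L) -mulrA ler_pM2l//.
move: yu yv; rewrite -!ball_normE /= => yu yv.
by apply: le_trans (ler_distD y _ _) _; rewrite (distrC u y) mulr_natl mulr2n ltW// ltrD.
Qed.

Lemma hausdorff_nullP s A :
  hausdorff_measure s A = 0%E <->
  forall eps, 0 < eps -> hausdorff_premeasure s eps A = 0%E.
Proof.
split=> [null eps eps0|null].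
  apply/eqP; rewrite eq_le hausdorff_premeasure_ge0 andbT -null.
  by apply: ereal_sup_ubound; exists eps.
apply/eqP; rewrite eq_le; apply/andP; split.
  by apply: ge_ereal_sup => _ [eps eps0 <-]; rewrite null.
by rewrite -(null 1 ltr01); apply: ereal_sup_ubound; exists 1 => /=.
Qed.

Lemma hausdorff_null_set0 s : 0 < s -> hausdorff_measure s (set0 : set 'rV[R]_d) = 0%E.
Proof.
move=> s0; apply/hausdorff_nullP => eps eps0; apply/eqP.
rewrite eq_le hausdorff_premeasure_ge0 andbT.
have := @hausdorff_premeasure_seq s eps 0 set0 [::] s0.
by rewrite lexx (ltW eps0) mul0r; apply.
Qed.

Lemma hausdorff_null_subset s A B : A `<=` B -> hausdorff_measure s B = 0%E ->
  hausdorff_measure s A = 0%E.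
Proof.
move=> AB /hausdorff_nullP B0; apply/hausdorff_nullP => eps eps0; apply/eqP.
by rewrite eq_le hausdorff_premeasure_ge0 andbT -(B0 eps eps0) le_hausdorff_premeasure.
Qed.

Lemma hausdorff_null_bigcup s (A : nat -> set 'rV[R]_d) :
  (forall n, hausdorff_measure s (A n) = 0%E) ->
  hausdorff_measure s (\bigcup_n A n) = 0%E.
Proof.
move=> null; apply/hausdorff_nullP => eps eps0; apply/eqP.
rewrite eq_le hausdorff_premeasure_ge0 andbT.
apply: le_trans (hausdorff_premeasure_bigcup _ _ _) _.
by rewrite eseries0// => n _ _; exact: (hausdorff_nullP _ _).1 (null n) _ eps0.
Qed.

Lemma hausdorff_null_limsup s A (B : nat -> set 'rV[R]_d) (C x : R) :
  0 <= x < 1 -> (forall N, A `<=` \bigcup_n B (N + n)%N) ->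
  (forall eps, 0 < eps -> \forall n \near \oo,
     (hausdorff_premeasure s eps (B n) <= (C * x ^+ n)%:E)%E) ->
  hausdorff_measure s A = 0%E.
Proof.
move=> x01 AB Bx; apply/hausdorff_nullP => eps eps0; apply/eqP.
rewrite eq_le hausdorff_premeasure_ge0 andbT; apply/lee_addgt0Pr => e e0; rewrite add0e.
have tail0 : (fun n => C / (1 - x) * x ^+ n) @ \oo --> (0 : R).
  by apply: cvg_geometric; case/andP: x01 => x0 x1; rewrite ger0_norm.
have [N0 _ BxN] := Bx eps eps0.
have [N1 _ tail_lt] := (cvgrPdist_lt _ _).1 tail0 e e0.
pose N := maxn N0 N1.
apply: le_trans (le_hausdorff_premeasure _ _ (AB N)) _.
apply: le_trans (hausdorff_premeasure_bigcup _ _ _) _.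
apply: (@le_trans _ _ (\sum_(0 <= n <oo) (C * x ^+ N * x ^+ n)%:E)%E).
  apply: lee_nneseries => n _; first by move=> _; exact: hausdorff_premeasure_ge0.
  by rewrite -mulrA -exprD; apply: BxN; rewrite /= (leq_trans (leq_maxl N0 N1))// leq_addr.
rewrite nneseries_geometric// lee_fin mulrAC.
have := tail_lt N (leq_maxr _ _); rewrite /= sub0r normrN => /ltW.
exact/le_trans/ler_norm.
Qed.

Lemma hausdorff_dim_le A (b : R) : 0 <= b ->
  (forall s, b < s -> hausdorff_measure s A = 0%E) -> (hausdorff_dim A <= b%:E)%E.
Proof.
move=> b0 null; apply/lee_addgt0Pr => e e0.
apply: ereal_inf_lbound; exists (b + e) => //=; split.
  by rewrite ltr_wpDl.
by apply: null; rewrite ltrDl.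
Qed.

End Hausdorff.

(** * Countable decompositions *)

Lemma sigma_ideal_local {T : topologicalType} (I : set (set T)) (X : set T) :
  @second_countable T -> I set0 -> (forall A B, A `<=` B -> I B -> I A) ->
  (forall F : nat -> set T, (forall n, I (F n)) -> I (\bigcup_n F n)) ->
  (forall x, X x -> exists2 V, nbhs x V & I (X `&` V)) -> I X.
Proof.
move=> [B /pfcard_geP[B0|[e]] [oB basisB]] I0 Isub Icup Iloc.
  apply: Isub I0 => x Xx; have [V Vx _] := Iloc x Xx.
  by have [W [+ _] _] := basisB x V Vx; rewrite B0.
pose F n := if pselect (I (X `&` e n)) then X `&` e n else set0.
have IF n : I (F n) by rewrite /F; case: pselect.
apply: (Isub _ _ _ (Icup F IF)) => x Xx; have [V Vx IV] := Iloc x Xx.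
have [W [BW Wx] WV] := basisB x V Vx.
have [n _ enW] := 'surj_e BW; exists n => //; rewrite /F enW.
case: pselect => // notI; exfalso; apply: notI; apply: (Isub _ _ _ IV).
exact: setIS.
Qed.

Section RowSpaces.
Context {R : realType}.

Lemma rational_row_dense {k : nat} (x : 'rV[R]_k) (e : R) : 0 < e ->
  exists w : 'rV[rat]_k, ball x e (map_mx ratr w).
Proof.
move=> e0.
have near_coord (i : 'I_k) : exists q : rat, `|x ord0 i - ratr q| < e / 2.
  have [|q] := @rat_in_itvoo R (x ord0 i - e / 2) (x ord0 i + e / 2).
    by rewrite ltrD2l gt0_cp// divr_gt0.
  by rewrite in_itv /= => /andP[q1 q2]; exists q; rewrite ltr_distlC q1.
have [f f_near] := choice near_coord; exists (\row_i f i).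
rewrite -ball_normE /=; apply: (@le_lt_trans _ _ (e / 2)); last by lra.
by apply: ler_norm_coord => [|i]; [rewrite divr_ge0// ltW|rewrite !mxE ltW].
Qed.

Lemma second_countable_row (k : nat) : @second_countable 'rV[R]_k.
Proof.
pose B (t : 'rV[rat]_k * nat) : set 'rV[R]_k :=
  ball (map_mx ratr t.1 : 'rV[R]_k) t.2.+1%:R^-1.
exists (range B); first exact: sub_countable (card_image_le _ _) (countableP _).
split=> [_ [t _ <-]|x V /nbhs_ballP[e /= e0 eV]]; first exact: ball_open.
have [n] := ltr_add_invr (divr_gt0 e0 (ltr0Sn _ 1)); rewrite add0r => ne.
have [w xw] := rational_row_dense x (e := n.+1%:R^-1) ltac:(by rewrite invr_gt0).
exists (B (w, n)); first by split; [exists (w, n)|exact: ball_sym].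
move=> y wy; apply: eV; apply: le_ball (ball_triangle xw wy).
by rewrite [leRHS]splitr lerD ?ltW.
Qed.

Lemma measure_support_neq0 {k : nat} (mu : {measure set (borel_row R k) -> \bar R}) :
  mu setT <> 0%E -> exists u, measure_support mu u.
Proof.
move=> mu0; apply: contrapT => empty; apply: mu0.
suff [B [mB B0 TB]] : mu.-negligible (setT : set (borel_row R k)).
  by rewrite (_ : setT = B)//; apply/seteqP; split.
apply: (sigma_ideal_local (I := fun A => mu.-negligible (A : set (borel_row R k)))).
- exact: second_countable_row.
- exact: negligible_set0.
- by move=> A B AB [N [mN N0 BN]]; exists N; split => //; exact: subset_trans BN.
- by move=> F; exact: (@negligible_bigcup _ (borel_row R k) R mu F).
move=> x _; have : ~ measure_support mu x by move=> xs; apply: empty; exists x.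
move=> /not_andP[/(_ I)//|/existsNP[V /not_implyP[oV /not_implyP[Vx /negP]]]].
rewrite -leNgt => V0; exists V; first exact: open_nbhs_nbhs.
exists V; split; [exact: measurable_open_rV|apply/eqP|by move=> y []].
by rewrite eq_le V0 measure_ge0.
Qed.

End RowSpaces.

Lemma support_chart_pushforward {R : realType} {k d : nat}
    (mu : {measure set (borel_row R k) -> \bar R})
    (U : set 'rV[R]_k) (M : set 'rV[R]_d) (psi : 'rV[R]_k -> 'rV[R]_d) :
  local_chart U M psi ->
  support_in (psi @` U) (chart_pushforward mu U psi) `<=` psi @` measure_support mu.
Proof.
move=> [oU psi_smooth _ [phi phiK phi_smooth]] _ [[u Uu <-] pos].
exists u => //; split=> // W oW Wu.
have [V [g [oV Vu g_smooth gphi]]] := phi_smooth (psi u) (imageP _ Uu).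
have : nbhs (psi u) (V `&` g @^-1` W).
  apply: filterI; first exact: open_nbhs_nbhs.
  apply: ((g_smooth 0%N).1 (psi u) Vu); rewrite gphi// phiK//.
  exact: open_nbhs_nbhs.
rewrite nbhsE => -[V' [oV' V'u] V'VW].
apply: lt_le_trans (pos V' oV' V'u) _; rewrite /chart_pushforward.
apply: le_measure; rewrite ?inE.
- apply: measurable_open_rV; rewrite openE => y [Uy V'y]; apply: filterI.
    exact: open_nbhs_nbhs.
  by apply: ((psi_smooth 0%N).1 y Uy); exact: open_nbhs_nbhs.
- exact: measurable_open_rV.
by move=> y [Uy V'y]; have [Vy Wy] := V'VW _ V'y; rewrite -(phiK y Uy) -gphi.
Qed.

Section Approximation.
Context {R : realType} {d : nat}.
Implicit Types (Z : set 'rV[R]_d) (x : 'rV[R]_d) (c C : R).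

Definition approximable Z c : set 'rV[R]_d :=
  [set x | forall N : nat, exists p q, [/\ (N <= q)%N, (0 < q)%N,
    Z (rational_point R p q) & `|x - rational_point R p q| <= q%:R `^ (- c)]].

Lemma finite_bounded_int_rows (B : nat) :
  finite_set [set p : 'rV[int]_d | forall i, `|p ord0 i| <= B%:Z].
Proof.
pose f (t : {ffun 'I_d -> 'I_(2 * B).+1}) : 'rV[int]_d := \row_i ((t i : nat)%:Z - B%:Z).
apply: (sub_finite_set (B := range f)); last by apply: finite_image; exact: finite_finset.
move=> p /= pB.
have p0 i : 0 <= p ord0 i + B%:Z.
  by rewrite -lerBlDr sub0r; move: (pB i); rewrite ler_norml => /andP[].
have pB2 i : (absz (p ord0 i + B%:Z)%R < (2 * B).+1)%N.
  rewrite ltnS -lez_nat gez0_abs// mul2n -addnn PoszD lerD2r.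
  by move: (pB i); rewrite ler_norml => /andP[].
exists [ffun i => Ordinal (pB2 i)] => //; apply/rowP => i.
by rewrite mxE ffunE /= gez0_abs// addrK.
Qed.

Lemma finite_bounded_rationals x C (N : nat) :
  finite_set [set r | exists p q, [/\ (0 < q)%N, (q < N)%N, r = rational_point R p q &
    `|x - r| <= C]].
Proof.
pose B := (Num.truncn (N%:R * (`|x| + C))).+1.
pose f (t : nat * 'rV[int]_d) := rational_point R t.2 t.1.
apply: (sub_finite_set
  (B := f @` (`I_N `*` [set p : 'rV[int]_d | forall i, `|p ord0 i| <= B%:Z]))); last first.
  by apply: finite_image; apply: finite_setX => //; exact: finite_bounded_int_rows.
move=> _ [p [q [q0 qN -> xC]]]; exists (q, p) => //; split=> //= i.
have qR_gt0 : 0 < q%:R :> R by rewrite ltr0n.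
have : `|(p ord0 i)%:~R| <= N%:R * (`|x| + C) :> R.
  have -> : (p ord0 i)%:~R = q%:R * (rational_point R p q ord0 i).
    by rewrite mxE mulrC divfK// gt_eqF.
  rewrite normrM ger0_norm//; apply: ler_pM => //; first by rewrite ler_nat ltnW.
  apply: le_trans (ler_coord_norm _ i) _; rewrite -[rational_point _ _ _](subrK x) addrC.
  by apply: le_trans (ler_normD _ _) _; rewrite lerD2l distrC.
move=> /le_lt_trans/(_ (truncnS_gt _)); rewrite -intr_norm => pB.
by rewrite -(ler_int R) ltW.
Qed.

Lemma infinite_good_approximable Z x c c' C : 0 <= c' -> c < c' -> 0 < C ->
  infinite_set (good_rational_points Z x c' C) -> approximable Z c x.
Proof.
move=> c'0 cc' C0 inf N; have e0 : 0 < c' - c by rewrite subr_gt0.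
pose N' := maxn N (Num.truncn (C `^ (c' - c)^-1)).+1.
apply: contrapT => none; apply: inf.
apply: sub_finite_set (finite_bounded_rationals x C N') => r [Zr [p [q [[q0 _] rE xr]]]].
have q1 : 1 <= q%:R :> R by rewrite ler1n.
exists p, q; split=> //; last first.
  apply: le_trans xr _; rewrite ler_piMr ?(ltW C0)//.
  have c'N : - c' <= 0 by rewrite oppr_le0.
  by have := ler_powR q1 c'N; rewrite powRr0.
rewrite ltnNge; apply/negP => N'q; apply: none; exists p, q; split=> //.
- by apply: leq_trans N'q; rewrite leq_maxl.
- by rewrite -rE.
rewrite -rE; apply: le_trans xr _.
have -> : - c = (c' - c) + - c' by ring.
have qp : 0 < q%:R :> R by rewrite ltr0n.
rewrite powRD; last by rewrite (gt_eqF qp) implybT.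
rewrite ler_pM2r ?powR_gt0//.
have Cq : C `^ (c' - c)^-1 <= q%:R.
  apply: ltW; apply: lt_le_trans (truncnS_gt _) _; rewrite ler_nat.
  by apply: leq_trans N'q; rewrite leq_maxr.
have -> : C = (C `^ (c' - c)^-1) `^ (c' - c).
  by rewrite -powRrM mulVf ?gt_eqF// powRr1// ltW.
by apply: ge0_ler_powR => //; rewrite ?nnegrE ?powR_ge0 ?(ltW e0)// ltW.
Qed.

Lemma very_well_approx_approximable Z c :
  very_well_approx c Z `<=` \bigcup_j approximable Z (c + j.+1%:R^-1).
Proof.
move=> x [_ /ereal_sup_gt[_ [c' [c'0 [C C0 inf]] <-]]]; rewrite lte_fin => cc'.
have [j jlt] := ltr_add_invr cc'; exists j => //.
exact: infinite_good_approximable (ltW c'0) jlt C0 inf.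
Qed.

Lemma approximable_dyadic {k : nat} (P : mpoly d int) (psi : 'rV[R]_k -> 'rV[R]_d) u c N :
  0 <= c -> approximable (zero_locus P) c (psi u) ->
  exists n, near_rational_zeros P psi (2 ^+ (N + n).+1) ((2 ^+ (N + n)) `^ (- c)) u.
Proof.
move=> c0 /(_ (2 ^ N)%N)[p [q [Nq q0 Zq uq]]].
have /andP[lo hi] := trunc_log_bounds (isT : (1 < 2)%N) q0.
have Nm : (N <= trunc_log 2 q)%N by apply: trunc_log_max.
exists (trunc_log 2 q - N)%N; rewrite subnKC//; exists (rational_point R p q).
  by split=> //; exists p, q; split=> //; rewrite -natrX ler_nat ltnW.
apply: le_trans uq _; rewrite !powRN lef_pV2 ?posrE ?powR_gt0 ?exprn_gt0 ?ltr0n//.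
by apply: ge0_ler_powR; rewrite ?nnegrE ?exprn_ge0// -natrX ler_nat.
Qed.

End Approximation.

(** * The limsup set *)

Lemma near_expr_le {R : realType} (t e : R) : 0 <= t < 1 -> 0 < e ->
  \forall n \near \oo, t ^+ n <= e.
Proof.
by move=> /andP[t0 t1] e0; apply: cvgr_le e0; apply: cvg_expr; rewrite ger0_norm.
Qed.

Lemma powR_exprn {R : realType} (y e : R) n : 0 <= y -> (y ^+ n) `^ e = (y `^ e) ^+ n.
Proof.
move=> y0; elim: n => [|n IH]; first by rewrite !expr0 powR1.
by rewrite !exprS powRM ?exprn_ge0// IH.
Qed.

Lemma powRN_lt1 {R : realType} (a x : R) : 1 < a -> 0 < x -> a `^ (- x) < 1.
Proof.
move=> a1 x0; rewrite /powR gt_eqF ?(lt_trans ltr01)//= expR_lt1 mulNr oppr_lt0.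
by rewrite mulr_gt0// ln_gt0.
Qed.

Section DyadicBlocks.
Context {R : realType} {k d : nat} (P : mpoly d int) (psi : 'rV[R]_k -> 'rV[R]_d).
Context (mu : {measure set (borel_row R k) -> \bar R}).
Context (alpha delta rho0 Cd C : R) (u0 : 'rV[R]_k) (rad L K kap c c' s : R).
Hypotheses (Cd_gt0 : 0 < Cd) (C_ge1 : 1 <= C).
Hypothesis decay : decaying_below mu alpha Cd rho0.
Hypothesis regular : regular_below mu delta C rho0.
Hypotheses (su0 : measure_support mu u0) (rad_gt0 : 0 < rad) (rad_le : 2 * rad <= rho0).
Hypotheses (L_gt0 : 0 < L) (K_gt0 : 0 < K) (kap_gt0 : 0 < kap).
Hypothesis lip : L.-lipschitz_(ball u0 rad) psi.
Hypothesis flat : flat_near_rational_zeros P psi (ball u0 rad) K kap.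
Hypotheses (c_ge1 : 1 <= c) (c_lt : c < c').
Hypotheses (s_gt0 : 0 < s) (s_gt : delta - alpha * (1 - 1 / c) < s).

Definition dyadic_block n : set 'rV[R]_k :=
  [set u | [/\ measure_support mu u, ball u0 rad u &
    near_rational_zeros P psi (2 ^+ n.+1) ((2 ^+ n) `^ (- c')) u]].

(* With rho := y^n, a point of the n-th block is within rho^c of a rational
   point of height at most 2^(n+1), and 2^n rho tends to 0. *)
Let y : R := 2 `^ (- (c' / c)).

Let c_gt0 : 0 < c. Proof. exact: lt_le_trans c_ge1. Qed.

Let ratio_gt1 : 1 < c' / c. Proof. by rewrite ltr_pdivlMr// mul1r. Qed.

Let y_gt0 : 0 < y. Proof. exact: powR_gt0. Qed.

Let y_lt1 : y < 1.
Proof. by apply: powRN_lt1; rewrite ?ltr1n// (lt_trans _ ratio_gt1). Qed.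

Let powR_y_lt1 e : 0 < e -> y `^ e < 1.
Proof.
move=> e0; rewrite /y -powRrM mulNr powRN_lt1 ?ltr1n// mulr_gt0//.
exact: lt_trans ratio_gt1.
Qed.

Let double_y_lt1 : 2 * y < 1.
Proof.
rewrite /y -{1}(powRr1 (a := 2))// -powRD; last by rewrite pnatr_eq0 implybT.
by rewrite -[1 - _]opprB powRN_lt1 ?ltr1n// subr_gt0.
Qed.

Let block_radius n : (2 ^+ n) `^ (- c') = (y ^+ n) `^ c.
Proof.
rewrite !powR_exprn ?powR_ge0// /y -powRrM; congr (_ `^ _ ^+ _).
by rewrite mulNr divfK// gt_eqF.
Qed.

Lemma dyadic_block_cover : exists A : R, \forall n \near \oo,
  ball_cover_le ((y ^+ n) `^ c) (A * (y ^+ n) `^ ((c - 1) * alpha - c * delta))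
    (dyadic_block n).
Proof.
have [A cover] := multiscale_cover Cd_gt0 C_ge1 decay regular c_ge1 K_gt0 rad_gt0 rad_le.
have y01 : 0 <= y < 1 by rewrite y_lt1 ltW.
have y201 : 0 <= 2 * y < 1 by rewrite double_y_lt1 mulr_ge0// ltW.
exists A; near=> n; have yn_gt0 : 0 < y ^+ n by rewrite exprn_gt0.
have rho_kap : y ^+ n <= kap by near: n; exact: near_expr_le.
have rho_rad : y ^+ n <= rad by near: n; exact: near_expr_le.
have rhoQ : y ^+ n * 2 ^+ n.+1 <= kap.
  have : (2 * y) ^+ n <= kap / 2 by near: n; apply: near_expr_le => //; exact: divr_gt0.
  by rewrite exprMn ler_pdivlMr// mulrC mulrA -exprS mulrC.
apply: (cover _ u0) => //.
- by move=> u [].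
- by move=> u [].
- by rewrite yn_gt0.
- by rewrite exprn_ile1// ltW.
move=> r /andP[tau_r r_rho]; have r0 : 0 < r by apply: lt_le_trans tau_r; exact: powR_gt0.
apply: (flat (Q := 2 ^+ n.+1)).
- by move=> u [].
- by move=> u [_ _]; rewrite block_radius.
- by rewrite powR_ge0.
- by rewrite r0 (le_trans r_rho).
- by apply: le_trans rhoQ; rewrite ler_wpM2r// exprn_ge0.
Unshelve. all: by end_near. Qed.

Lemma dyadic_block_premeasure : exists A x : R, 0 <= x < 1 /\
  forall eps, 0 < eps -> \forall n \near \oo,
    (hausdorff_premeasure s eps (psi @` dyadic_block n) <= (A * x ^+ n)%:E)%E.
Proof.
have [A cover] := dyadic_block_cover.
pose eta := (c - 1) * alpha - c * delta + c * s.
have eta0 : 0 < eta.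
  have : c * (delta - alpha * (1 - 1 / c)) < c * s by rewrite ltr_pM2l.
  have -> : c * (delta - alpha * (1 - 1 / c)) = c * delta - (c - 1) * alpha.
    by field; rewrite gt_eqF.
  by rewrite /eta; lra.
exists (A * (2 * L) `^ s), (y `^ eta); split; first by rewrite powR_ge0 powR_y_lt1.
have yc01 : 0 <= y `^ c < 1 by rewrite powR_ge0 powR_y_lt1.
move=> eps eps0; near=> n.
have tau_eps : 2 * L * (y ^+ n) `^ c <= eps.
  rewrite mulrC -ler_pdivlMr ?mulr_gt0// powR_exprn ?(ltW y_gt0)//.
  by near: n; apply: near_expr_le => //; rewrite divr_gt0// mulr_gt0.
have covn : ball_cover_le ((y ^+ n) `^ c)
    (A * (y ^+ n) `^ ((c - 1) * alpha - c * delta)) (dyadic_block n) by near: n.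
apply: le_trans (hausdorff_premeasure_lipschitz_image s_gt0 L_gt0 _ tau_eps covn _) _.
- exact: powR_ge0.
- apply/klipschitzP => u v [_ ub _] [_ vb _].
  exact: (klipschitzP _ _ _).1 lip u v ub vb.
have yn_neq0 : y ^+ n != 0 by rewrite gt_eqF// exprn_gt0.
rewrite lee_fin -powR_exprn ?(ltW y_gt0)// /eta [in leRHS]powRD; last first.
  by rewrite yn_neq0 implybT.
rewrite powRM ?powR_ge0 ?mulr_ge0 ?(ltW L_gt0)// -powRrM.
by rewrite mulrACA.
Unshelve. all: by end_near. Qed.

Lemma approximable_ball_null :
  hausdorff_measure s (psi @` [set u | [/\ measure_support mu u, ball u0 rad u &
    approximable (zero_locus P) c' (psi u)]]) = 0%E.
Proof.
have [A [x [x01 small]]] := dyadic_block_premeasure.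
apply: hausdorff_null_limsup x01 _ small => N _ [u [su ub approx] <-].
have c'0 : 0 <= c' by rewrite (le_trans (ltW c_gt0))// ltW.
have [n near_n] := approximable_dyadic N c'0 approx.
by exists n => //; exists u.
Qed.

End DyadicBlocks.

Section LocalToGlobal.
Context {R : realType} {k d : nat} (P : mpoly d int) (psi : 'rV[R]_k -> 'rV[R]_d).
Context (mu : {measure set (borel_row R k) -> \bar R}) (alpha delta rho0 Cd C : R).
Context (U : set 'rV[R]_k) (M : set 'rV[R]_d) (c s : R).
Hypotheses (d_le : (d <= k.+1)%N) (quadP : quadratic P) (irrP : irreducible_over_rat P).
Hypotheses (rho0_gt0 : 0 < rho0) (Cd_gt0 : 0 < Cd) (C_ge1 : 1 <= C).
Hypothesis decay : decaying_below mu alpha Cd rho0.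
Hypothesis regular : regular_below mu delta C rho0.
Hypotheses (chart : local_chart U M psi) (supp_U : measure_support mu `<=` U).
Hypotheses (c_ge1 : 1 <= c) (s_gt0 : 0 < s) (s_gt : delta - alpha * (1 - 1 / c) < s).

Let approx_support c' : set 'rV[R]_k :=
  [set u | measure_support mu u /\ approximable (zero_locus P) c' (psi u)].

Lemma approximable_locally_null c' u0 : c < c' -> measure_support mu u0 ->
  exists2 V, nbhs u0 V & hausdorff_measure s (psi @` (approx_support c' `&` V)) = 0%E.
Proof.
move=> c_lt su0; have [r [L [K [kap [r_gt0 L0 K0 kap0 [lip flat]]]]]] :=
  near_rational_zeros_flat d_le quadP irrP chart (supp_U su0).
pose rad := Num.min r (rho0 / 2).
have rad0 : 0 < rad by rewrite lt_min r_gt0 divr_gt0.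
have rad_le : 2 * rad <= rho0 by rewrite mulrC -ler_pdivlMr// ge_min lexx orbT.
have rad_sub : ball u0 rad `<=` ball u0 r by apply: le_ball; rewrite ge_min lexx.
exists (ball u0 rad); first exact: nbhsx_ballx.
apply: hausdorff_null_subset (approximable_ball_null Cd_gt0 C_ge1 decay regular su0
  rad0 rad_le L0 K0 kap0 _ _ c_ge1 c_lt s_gt0 s_gt).
- by apply: image_subset => u [[su approx] ub]; split.
- apply/klipschitzP => u v /rad_sub ub /rad_sub vb.
  exact: (klipschitzP _ _ _).1 lip u v ub vb.
- by move=> E Q tau t Erad; apply: flat; exact: subset_trans rad_sub.
Qed.

Lemma approximable_support_null c' : c < c' ->
  hausdorff_measure s (psi @` approx_support c') = 0%E.
Proof.
move=> c_lt.
apply: (sigma_ideal_local (I := fun A => hausdorff_measure s (psi @` A) = 0%E)).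
- exact: second_countable_row.
- by rewrite image_set0; exact: hausdorff_null_set0.
- by move=> A B AB; apply: hausdorff_null_subset; exact: image_subset.
- by move=> F nullF; rewrite image_bigcup; exact: hausdorff_null_bigcup.
by move=> u [su _]; exact: approximable_locally_null.
Qed.

Lemma very_well_approx_support_null :
  hausdorff_measure s (very_well_approx c (zero_locus P) `&`
    support_in (psi @` U) (chart_pushforward mu U psi)) = 0%E.
Proof.
apply: (hausdorff_null_subset
  (B := \bigcup_j (psi @` approx_support (c + j.+1%:R^-1)))).
  move=> z [/very_well_approx_approximable[j _ approx]].
  move=> /(support_chart_pushforward chart)[u su uz].
  by exists j => //; exists u => //; split; rewrite ?uz.
apply: hausdorff_null_bigcup => j; apply: approximable_support_null.
by rewrite ltrDl invr_gt0.
Qed.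

End LocalToGlobal.

Theorem theorem1p2 (R : realType) (d : nat) (hd : (2 <= d)%N)
    (P : mpoly d int) (hP : quadratic P) (hPirr : irreducible_over_rat P)
    (alpha delta : R)
    (mu : {measure set borel_row R d.-1 -> \bar R})
    (hmu0 : mu setT <> 0%E) (hmufin : locally_finite mu)
    (hfriendly : absolutely_friendly alpha mu)
    (hregular : ahlfors_regular delta mu)
    (U : set 'rV[R]_d.-1) (hU : open U) (hsupp : measure_support mu `<=` U)
    (psi : 'rV[R]_d.-1 -> 'rV[R]_d)
    (hpsi : local_chart U (regular_locus P) psi)
    (c : R) (hc : 1 <= c) :
  (hausdorff_dim
     (very_well_approx c (zero_locus P) `&`
      support_in (psi @` U) (chart_pushforward mu U psi))
   <= (delta - alpha * (1 - 1 / c))%:E)%E.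
Proof.
have [[alpha0 _] _] := hfriendly.
have [rho0 [Cd [C [rho00 Cd0 C1 [decay regular]]]]] :=
  decaying_regular_common_scale hfriendly.1 hregular.
have [u0 su0] := measure_support_neq0 hmu0.
have k0 : (0 < d.-1)%N by case: (d) hd => [|[]].
have alpha_delta := decay_exponent_le_dimension rho00 Cd0 C1 decay regular k0 su0.
have bound_ge0 : 0 <= delta - alpha * (1 - 1 / c).
  rewrite subr_ge0; apply: le_trans alpha_delta; rewrite ler_piMr ?(ltW alpha0)//.
  by rewrite gerBl divr_ge0// (le_trans _ hc).
apply: hausdorff_dim_le => // s s_gt; have s0 : 0 < s by apply: le_lt_trans s_gt.
exact: very_well_approx_support_null (leqSpred d) hP hPirr rho00 Cd0 C1 decay regular
  hpsi hsupp hc s0 s_gt.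
Qed.
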